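(* Let $g\geq 0$ and $d>0$ be integers, let $\beta=(\beta_1\geq\dots\geq\beta_n)$ be a partition of $d$ of odd length $n$, and let $s$ be the integer with $2s=2g-1+n$. Then \[ H^{g,(2)}_{(d),\beta} = \frac{s!\,d^{s-1}}{2^s} \sum_{h=0}^g \frac{(2s-2h)!}{h!\,(s-h)!\,12^h}\,d^{2h}\,\left[z^{2(g-h)}\right]\prod_{i\geq 1}\left(\frac{\sinh(iz/2)}{iz/2}\right)^{c_i} =\frac{s!\,d^{s-1}}{2^{s+2g}} \sum_{h=0}^g \frac{(2s-2h)!}{h!\,(s-h)!\,3^h}\,d^{2h} \sum_{\lambda\vdash (g-h)}\frac{\xi_{2\lambda}S_{2\lambda}}{|\mathrm{Aut}\,\lambda|}. \]
   Context: For a partition $\lambda=(\lambda_1\geq\lambda_2\geq\dots)$ and $k\geq1$, the shifted symmetric power sum is $p_k(\lambda)=\sum_{i\geq1}\big((\lambda_i-i+\tfrac12)^k-(-i+\tfrac12)^k\big)$ (with $\lambda_i=0$ for $i>l(\lambda)$). For partitions $\alpha,\beta$ of $d$ of lengths $m,n$, and integers $g,r,s\geq0$ with $rs=2g-2+m+n$, the disconnected double Hurwitz number with completed $(r+1)$-cycles is $H^{g,(r)}_{\alpha,\beta}=\frac{1}{\prod_i\alpha_i\prod_j\beta_j}\sum_{\lambda\vdash d}\chi^\lambda_\alpha\left(\frac{p_{r+1}(\lambda)}{(r+1)!}\right)^s\chi^\lambda_\beta$, where $\chi^\lambda_\mu$ is the irreducible character of $S_d$ indexed by $\lambda$ evaluated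 on the class of cycle type $\mu$. Here $r=2$ and $\alpha=(d)$. Let $n_i$ be the number of parts of $\beta$ equal to $i$; set $c_1=n_1-1$ and $c_i=n_i$ for $i\geq2$. $[z^j]f$ denotes the coefficient of $z^j$ in the series $f$. For $j\geq1$, $\xi_{2j}=[x^{2j}]\log(\sinh x/x)$ and $S_{2j}=-1+\sum_{k}\beta_k^{2j}$. For a partition $\lambda$, $\xi_{2\lambda}=\prod_i\xi_{2\lambda_i}$, $S_{2\lambda}=\prod_i S_{2\lambda_i}$ (both equal to $1$ for the empty partition), and $|\mathrm{Aut}\,\lambda|=\prod_i m_i!$ where $m_i$ is the number of parts of $\lambda$ equal to $i$. *)

(* Defs.v *)
From HB Require Import structures.
From mathcomp Require Import all_boot all_order all_algebra.
From mathcomp Require Import all_fingroup all_field all_character.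

Set Implicit Arguments.
Unset Strict Implicit.
Unset Printing Implicit Defensive.

Import Order.TTheory GRing.Theory Num.Theory.
Local Open Scope ring_scope.

(** * Integer partitions *)

Definition is_partition (d : nat) (s : seq nat) : bool :=
  [&& sorted geq s, 0%N \notin s & sumn s == d].

(* A partition of d has at most d parts, each at most d, so it is obtained by
   deleting the zeros of some d-tuple with entries in {0, ..., d}. *)
Definition partitions (d : nat) : seq (seq nat) :=
  [seq s <- undup [seq [seq i <- map val t | 0 < i]%N
                  | t : d.-tuple 'I_d.+1] | is_partition d s].

Lemma partitions_uniq d : uniq (partitions d).
Proof. by rewrite filter_uniq ?undup_uniq. Qed.

Lemma mem_partitions d s : (s \in partitions d) = is_partition d s.
Proof.
rewrite mem_filter; case Ps: (is_partition d s) => //=.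
case/and3P: Ps => _ s0 /eqP sd; rewrite mem_undup.
have s_pos : all (fun i => 0 < i)%N s.
  by apply/allP => i si; rewrite lt0n; apply: contraNneq s0 => <-.
have sz : (size s <= d)%N.
  rewrite -sd; elim: s s_pos {s0 sd} => //= a s IH.
  by case/andP=> a0 /IH; apply: leq_add a0.
have bd i : i \in s -> (i < d.+1)%N.
  rewrite ltnS -sd; elim: s {s0 sd s_pos sz} => //= a s IH.
  by rewrite inE => /predU1P[->|/IH h];
    rewrite ?leq_addr ?(leq_trans h) ?leq_addl.
pose u := [seq inord i : 'I_d.+1 | i <- s ++ nseq (d - size s) 0%N].
have su : size u == d by rewrite size_map size_cat size_nseq subnKC.
apply/imageP; exists (Tuple su) => //=.
have -> : map val u = s ++ nseq (d - size s) 0%N.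
  rewrite -map_comp -[RHS]map_id; apply/eq_in_map => i.
  rewrite mem_cat mem_nseq => /orP[/bd h|/andP[_ /eqP->]] /=; exact: inordK.
rewrite filter_cat (all_filterP s_pos).
by rewrite (_ : filter _ (nseq _ _) = [::]) ?cats0 // filter_nseq.
Qed.

Definition aut_order (la : seq nat) : nat :=
  (\prod_(i <- undup la) (count_mem i la)`!)%N.

(* The terms with i > l(la) of the defining sum vanish. *)
Definition shifted_psum (F : fieldType) (k : nat) (la : seq nat) : F :=
  \sum_(i < size la)
    (((nth 0%N la i)%:R - i.+1%:R + 2%:R^-1) ^+ k
     - (- i.+1%:R + 2%:R^-1) ^+ k).

(** * Irreducible characters of the symmetric group *)

(* The box of index k in the row-by-row numbering of the diagram of la lies in
   row [reshape_index la k] and column [reshape_offset la k]; the two sets below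
   are the row and column stabilisers of the corresponding tableau. *)
Definition row_stab (d : nat) (la : seq nat) : {set 'S_d} :=
  [set p : 'S_d | [forall k, reshape_index la (p k) == reshape_index la k]].

Definition col_stab (d : nat) (la : seq nat) : {set 'S_d} :=
  [set p : 'S_d | [forall k, reshape_offset la (p k) == reshape_offset la k]].

Definition symreg (d : nat) := regular_repr algC [set: 'S_d]%G.

Definition young_symmetrizer (d : nat) (la : seq nat) :=
  (\sum_(p in row_stab d la) symreg d p)
  *m (\sum_(q in col_stab d la) (-1) ^+ odd_perm q *: symreg d q).

(* The Specht module: the submodule of the regular representation of 'S_d
   generated by the Young symmetrizer (with this convention the partition (d)
   yields the trivial representation). *)
Definition specht_repr (d : nat) (la : seq nat) :=
  submod_repr
    (cyclic_mx_module (symreg d) (gring_row (young_symmetrizer d la))).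

Definition specht_char (d : nat) (la : seq nat) : 'CF([set: 'S_d]) :=
  cfRepr (specht_repr d la).

Definition cycle_type (d : nat) (p : 'S_d) : seq nat :=
  sort geq [seq #|c| | c : {set 'I_d} <- enum (porbits p)].

(* Some permutation of cycle type mu; one exists whenever mu is a partition
   of d. *)
Definition perm_of_type (d : nat) (mu : seq nat) : 'S_d :=
  odflt 1%g [pick p : 'S_d | cycle_type p == mu].

Definition sym_char (d : nat) (la mu : seq nat) : algC :=
  specht_char d la (perm_of_type d mu).

(** * Disconnected double Hurwitz numbers with completed (r+1)-cycles *)

(* For partitions al, be of d and r * s = 2 g - 2 + l(al) + l(be), this is the
   number H^{g,(r)}_{al,be}; the genus enters its definition only through s. *)
Definition hurwitz (r s d : nat) (al be : seq nat) : algC :=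
  ((\prod_(a <- al) a)%N%:R * (\prod_(b <- be) b)%N%:R)^-1 *
  \sum_(la <- partitions d)
     sym_char d la al * (shifted_psum algC r.+1 la / (r.+1)`!%:R) ^+ s
     * sym_char d la be.

(** * Formal power series, given by their coefficients *)

Definition fps (F : fieldType) := nat -> F.

Definition fps1 (F : fieldType) : fps F := fun n => (n == 0%N)%:R.
Definition fps_sub (F : fieldType) (a b : fps F) : fps F := fun n => a n - b n.
Definition fps_mul (F : fieldType) (a b : fps F) : fps F :=
  fun n => \sum_(i < n.+1) a i * b (n - i)%N.
Definition fps_exp (F : fieldType) (a : fps F) (k : nat) : fps F :=
  iter k (fps_mul a) (fps1 F).

(* f(u(z)), for u with zero constant term: u^k then has no terms of degree
   smaller than k. *)
Definition fps_comp (F : fieldType) (f u : fps F) : fps F :=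
  fun n => \sum_(k < n.+1) f k * fps_exp u k n.

(* 1/a = \sum_k (1 - a)^k, for a with constant term 1. *)
Definition fps_inv (F : fieldType) (a : fps F) : fps F :=
  fps_comp (fun=> 1) (fps_sub (fps1 F) a).

Definition fps_expz (F : fieldType) (a : fps F) (c : int) : fps F :=
  match c with
  | Posz k => fps_exp a k
  | Negz k => fps_exp (fps_inv a) k.+1
  end.

(* log a = \sum_(k >= 1) (-1)^(k-1) (a - 1)^k / k, for a with constant
   term 1. *)
Definition fps_log (F : fieldType) (a : fps F) : fps F :=
  fps_comp (fun k => if k is k'.+1 then (-1) ^+ k' / k%:R else 0)
           (fps_sub a (fps1 F)).

Definition fps_scale (F : fieldType) (c : F) (a : fps F) : fps F :=
  fun n => c ^+ n * a n.

(* a(z)/z, for a with zero constant term. *)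
Definition fps_divX (F : fieldType) (a : fps F) : fps F := fun n => a n.+1.

Definition fps_sinh (F : fieldType) : fps F :=
  fun n => if odd n then (n`!%:R)^-1 else 0.

Definition fps_sinhc (F : fieldType) : fps F := fps_divX (fps_sinh F).

(** * The two right-hand sides *)

Definition c_mult (be : seq nat) (i : nat) : int :=
  (count_mem i be)%:Z - (i == 1%N)%:Z.

(* The product over i >= 1 of (sinh(iz/2)/(iz/2))^(c_i); as be is a partition
   of d > 0, c_i = 0 for i > d. *)
Definition sinh_product (d : nat) (be : seq nat) : fps algC :=
  \big[@fps_mul algC/@fps1 algC]_(1 <= i < d.+1)
    fps_expz (fps_scale (i%:R / 2%:R) (fps_sinhc algC)) (c_mult be i).

Definition xi (m : nat) : algC := fps_log (fps_sinhc algC) m.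

Definition Spow (be : seq nat) (m : nat) : algC :=
  -1 + \sum_(b <- be) b%:R ^+ m.

Definition xi_part (la : seq nat) : algC := \prod_(i <- la) xi (2 * i)%N.

Definition Spow_part (be la : seq nat) : algC :=
  \prod_(i <- la) Spow be (2 * i)%N.

(* Main.v *)
(* A function [f] on a finite group with [f * f = n f] generates an ideal whose
   character is read off [f] (ideal_charE). For the Young symmetrizer this gives
   irreducibility of the Specht characters; for the signed indicators of the
   stabilisers of [j]-subsets it gives the characters [psi_j] of the exterior
   powers of the permutation representation, whose generating function is
   [sum_j psi_j (-x)^j = prod_cycles (1 - x^length)].
   A sign-reversing argument with transpositions shows that a Specht character
   pairs to zero with all [psi_j] unless its shape is a hook, and that the hook
   [(d - k, 1^k)] pairs nontrivially with [psi_k] and [psi_(k+1)] only. As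
   [psi_j] has norm at most 2, it is the sum of the hook characters [k = j] and
   [k = j - 1], so
   [(1 - x) sum_k chi_k(be) (-x)^k = prod_j (1 - x^(be_j))].
   On a [d]-cycle the hooks take the values [(-1)^k], and its centraliser has
   order at most [d], so all other irreducible characters vanish there by the
   second orthogonality relation.
   With [w_k = (d-1)/2 - k] we have [p_3(hook)/6 = (d/2) (w_k^2 + d^2/12)], and
   substituting [x = exp(-z)] gives
   [sum_k (-1)^k chi_k(be) exp(w_k z) = prod_j 2 sinh(be_j z/2) / 2 sinh(z/2)];
   expanding the [s]-th power yields the first formula. The second one compares
   the recursions that the logarithmic derivative gives for the coefficients of
   the product of sinh's with those of the sum over partitions. *)

From HB Require Import structures.
Require Import Defs.
From mathcomp Require Import all_boot all_order all_algebra all_field.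
From mathcomp Require Import all_fingroup all_character boolp zify ring.

Set Implicit Arguments.
Unset Strict Implicit.
Unset Printing Implicit Defensive.

Import Order.TTheory GRing.Theory Num.Theory.
Local Open Scope ring_scope.

(** * Characters of ideals generated by quasi-idempotents *)

Section GroupRingCharacters.

Variables (gT : finGroupType).
Local Notation G := [set: gT]%G.
Local Notation aG := (regular_repr algC G).
Implicit Types (f : gT -> algC) (g h x : gT).

Definition gring_elt f := \sum_h f h *: aG h.

(** The regular representation acts by right multiplication, so this is the character of the right
    ideal [f C[G]]. *)
Definition ideal_char f : 'CF(G) :=
  cfRepr (submod_repr (cyclic_mx_module aG (gring_row (gring_elt f)))).

Definition quasi_idempotent f n :=
  forall g, \sum_h f h * f (h^-1 * g)%g = n * f g.

Lemma ideal_char_char f : ideal_char f \is a character.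
Proof. exact: cfRepr_char. Qed.

Local Notation idx := (@gring_index gT G).

Lemma gring_idxK : cancel idx enum_val.
Proof. by move=> x; rewrite gring_indexK ?inE. Qed.

Lemma gring_row_elt f : gring_row (gring_elt f) = \row_i f (enum_val i).
Proof.
apply/rowP => i; rewrite /gring_elt linear_sum summxE mxE (bigD1 (enum_val i)) //=.
rewrite big1 ?addr0 => [|h nhi].
  by rewrite linearZ !mxE gring_idxK mul1g gring_valK !eqxx mulr1.
rewrite linearZ !mxE gring_idxK mul1g eqxx [i == _](_ : _ = false) ?mulr0 //.
by apply: contraNF nhi => /eqP->; rewrite gring_idxK.
Qed.

Lemma row_mul_regular (u : 'rV[algC]_#|G|) g i : (u *m aG g) 0 i = u 0 (idx (enum_val i * g^-1)%g).
Proof.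
rewrite mxE (bigD1 (idx (enum_val i * g^-1)%g)) //= big1 ?addr0 => [|j nj].
  by rewrite !mxE gring_idxK mulgKV gring_valK !eqxx mulr1.
rewrite !mxE eqxx [i == _](_ : _ = false) ?mulr0 //.
by apply: contraNF nj => /eqP->; rewrite gring_idxK mulgK gring_valK.
Qed.

(* Left multiplication by [f] maps the regular module onto the ideal it
   generates; when [f * f = n f], the trace of [g] on the ideal is [1/n] times
   the trace of left multiplication by [f] followed by [g]. *)
Lemma ideal_charE f n g : quasi_idempotent f n ->
  n * ideal_char f g = \sum_x f (x * g^-1 * x^-1)%g.
Proof.
move=> ff; set u := gring_row (gring_elt f).
have uE i : u 0 i = f (enum_val i) by rewrite /u gring_row_elt mxE.
pose L : 'M_#|G| := \matrix_(i < #|G|) (u *m aG (enum_val i)).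
have LE i j : L i j = f (enum_val j * (enum_val i)^-1)%g.
  by rewrite mxE row_mul_regular uE gring_idxK.
have LL : L *m L = n *: L.
  apply/matrixP => i j; rewrite mxE [RHS]mxE LE -ff.
  under eq_bigr do rewrite !LE.
  rewrite (reindex (fun h => idx (h^-1 * enum_val j)%g)) /=; last first.
    exists (fun k => enum_val j * (enum_val k)^-1)%g => k _.
      by rewrite gring_idxK invMg invgK mulKVg.
    by rewrite invMg invgK mulgKV gring_valK.
  apply: eq_bigr => h _.
  by rewrite gring_idxK invMg invgK mulKVg mulrC !mulgA.
have Lcomm h : L *m aG h = aG h *m L.
  apply/row_matrixP => i; rewrite !row_mul !rowK -mulmxA -repr_mxM ?inE //.
  by rewrite -rowE rowK gring_idxK.
set U := cyclic_mx aG u; set B := row_base U.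
(* Row [i] of [L] is [f] times the [i]-th group element, so these rows span the right ideal. *)
have LU : (L :=: U)%MS.
  apply/eqmxP/andP; split.
    apply/row_subP => i; rewrite rowK; apply/cyclic_mxP.
    by exists (aG (enum_val i)); rewrite ?envelop_mx_id ?inE.
  apply: cyclic_mx_sub.
    by apply/mxmoduleP => h _; rewrite Lcomm submxMl.
  suff -> : u = row (idx 1%g) L by exact: row_sub.
  by rewrite rowK gring_idxK repr_mx1 mulmx1.
have BU : (B :=: U)%MS by exact: eq_row_base.
have /submxP[C LC] : (L <= B)%MS by rewrite BU LU.
have /submxP[D BD] : (B <= L)%MS by rewrite BU LU.
(* From [L = C *m B] and [B = D *m L]: [B *m C *m B = B *m L = D *m L *m L = n *: B], and the
   row-free [B] cancels. *)
have BC : B *m C = n%:M.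
  apply: (row_free_inj (row_base_free U)); rewrite -/B -mulmxA -LC.
  by rewrite mul_scalar_mx BD -mulmxA LL linearZ.
set Y := submod_mx (cyclic_mx_module aG u) g.
have BX : B *m aG g = Y *m B.
  have := val_submodJ (cyclic_mx_module aG u) 1%:M (in_setT g).
  by rewrite mul1mx /val_submod /= mul1mx.
(* Cyclicity of the trace: [C *m B *m aG g = C *m Y *m B] has the same trace as
   [B *m C *m Y = n *: Y]. *)
have -> : n * ideal_char f g = \tr (L *m aG g).
  rewrite LC -mulmxA BX mulmxA mxtrace_mulC mulmxA BC mul_scalar_mx linearZ /=.
  by rewrite cfunE in_setT mulr1n.
rewrite /mxtrace (reindex idx) /=; last first.
  by exists enum_val => k _; rewrite ?gring_idxK ?gring_valK.
apply: eq_bigr => x _.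
rewrite [LHS](_ : _ = (row (idx x) L *m aG g) 0 (idx x)); last by rewrite -row_mul [RHS]mxE.
by rewrite row_mul_regular mxE LE !gring_idxK.
Qed.

Lemma ideal_char1 f n : quasi_idempotent f n ->
  n * ideal_char f 1%g = #|gT|%:R * f 1%g.
Proof.
move=> /ideal_charE->; under eq_bigr do rewrite invg1 mulg1 mulgV.
by rewrite sumr_const mulr_natl.
Qed.

(** After inserting the trace formula [ideal_charE], all conjugators contribute equally, as [phi] is
    a class function. *)
Lemma cfdot_ideal_char f n (phi : 'CF(G)) : quasi_idempotent f n ->
  phi \is a character -> n * '[ideal_char f, phi] = \sum_t f t * phi t.
Proof.
move=> ff Nphi; rewrite cfdotE mulrCA mulr_sumr.
under eq_bigr do rewrite mulrA (ideal_charE _ ff) -char_inv // mulr_suml.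
rewrite exchange_big /=.
transitivity (#|G|%:R^-1 * \sum_(x in G) \sum_t f t * phi t).
  congr (_ * _); apply: eq_big => [x|x _]; first by rewrite !inE.
  rewrite (reindex_inj (@invg_inj _)) (reindex_inj (conjg_inj x)) /=.
  apply: eq_big => [t|t _]; first by rewrite !inE.
  rewrite !invgK cfunJ ?inE //; congr (f _ * _).
  by rewrite conjgE !mulgA mulgV mul1g mulgK.
rewrite sumr_const -[X in _ * X]mulr_natl; exact: mulKf (neq0CG _) _.
Qed.

End GroupRingCharacters.

(** * Exterior powers of the permutation representation *)

Section StabSign.

Variable T : finType.
Implicit Types (s t : {perm T}) (I J : {set T}) (x y : T).
Local Notation "''St' ( I )" := ('N(I | 'P))%g (format "''St' ( I )").

(** The diagonal matrix entry of [s] at the wedge of the basis vectors indexed by [I]. *)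
Definition stab_sign s I : algC :=
  if s \in 'St(I) then (-1) ^+ odd_perm (restr_perm I s) else 0.

Lemma stabP s I : reflect (forall x, (s x \in I) = (x \in I)) (s \in 'St(I)).
Proof. by apply: (iffP idP) => [h x|h]; [exact: (astabsP h x)|apply/astabsP]. Qed.

Lemma stab_imset s I : (s \in 'St(I)) = (s @: I == I).
Proof.
apply/stabP/eqP => [h|h x]; last first.
  by rewrite -{1}h mem_imset //; apply: perm_inj.
apply/setP => x; rewrite -(permKV s x) mem_imset ?h //; exact: perm_inj.
Qed.

Lemma stab_signMl s t I : s \in 'St(I) -> stab_sign (s * t)%g I = stab_sign s I * stab_sign t I.
Proof.
move=> Ns; rewrite /stab_sign Ns groupMl //; case: ifP => Nt; last by rewrite mulr0.
by rewrite morphM //= odd_permM signr_addb.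
Qed.

Lemma stab_signMr s t I : t \in 'St(I) -> stab_sign (s * t)%g I = stab_sign s I * stab_sign t I.
Proof.
move=> Nt; rewrite /stab_sign Nt groupMr //; case: ifP => Ns; last by rewrite mul0r.
by rewrite morphM //= odd_permM signr_addb.
Qed.

Lemma stab_sign1 I : stab_sign 1%g I = 1.
Proof. by rewrite /stab_sign group1 morph1 odd_perm1. Qed.

Lemma stab_signV s I : stab_sign s^-1%g I = stab_sign s I.
Proof.
rewrite /stab_sign groupV; case: ifP => // Ns.
by rewrite morphV //= odd_permV.
Qed.

Lemma stab_sign_sqr s I : stab_sign s I * stab_sign s I = (s \in 'St(I))%:R.
Proof.
by rewrite /stab_sign; case: ifP => _; rewrite ?mulr0 // -expr2 sqrr_sign.
Qed.

Lemma restr_perm_eq I s t : s \in 'St(I) -> {in I, s =1 t} ->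
  (forall x, x \notin I -> t x = x) -> restr_perm I s = t.
Proof.
move=> Ns st t1; apply/permP => x; have [Ix|nIx] := boolP (x \in I).
  by rewrite restr_permE // st.
by rewrite t1 // (out_perm (restr_perm_on _ _)).
Qed.

Lemma tperm_stab_in x y I : x \in I -> y \in I -> tperm x y \in 'St(I).
Proof. by move=> Ix Iy; apply/stabP => z; case: tpermP => [->|->|//]; rewrite Ix Iy. Qed.

Lemma tperm_stab_out x y I : x \notin I -> y \notin I -> tperm x y \in 'St(I).
Proof.
by move=> /negbTE Ix /negbTE Iy; apply/stabP => z; case: tpermP => [->|->|//]; rewrite Ix Iy.
Qed.

Lemma stab_sign_tperm_in x y I : x \in I -> y \in I -> x != y -> stab_sign (tperm x y) I = -1.
Proof.
move=> Ix Iy nxy; rewrite /stab_sign tperm_stab_in //.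
rewrite (@restr_perm_eq _ _ (tperm x y)) ?tperm_stab_in ?odd_tperm ?nxy // => z nIz.
by rewrite tpermD //; apply: contraNneq nIz => <-.
Qed.

Lemma stab_sign_tperm_out x y I : x \notin I -> y \notin I -> stab_sign (tperm x y) I = 1.
Proof.
move=> Ix Iy; rewrite /stab_sign tperm_stab_out //.
rewrite (@restr_perm_eq _ _ 1%g) ?tperm_stab_out ?odd_perm1 // => z; last by rewrite perm1.
move=> Iz; rewrite perm1 tpermD //; first by apply: contraNneq Ix => ->.
by apply: contraNneq Iy => ->.
Qed.

Lemma stab_signJ s t I : stab_sign (s ^ t)%g (t @: I) = stab_sign s I.
Proof.
have NJ : ((s ^ t)%g \in 'St(t @: I)) = (s \in 'St(I)).
  apply/stabP/stabP => h x; last first.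
    by rewrite -(permKV t x) permJ !mem_imset ?h //; apply: perm_inj.
  by have := h (t x); rewrite permJ !mem_imset //; apply: perm_inj.
rewrite /stab_sign NJ; case: ifP => // Ns.
rewrite -(odd_permJ (restr_perm I s) t); congr ((-1) ^+ odd_perm _).
apply: restr_perm_eq => [|_ /imsetP[x Ix ->]|y nIy]; first by rewrite NJ.
  by rewrite !permJ restr_permE.
rewrite -(permKV t y) permJ (out_perm (restr_perm_on _ _)) //.
by apply: contraNN nIy => /(imset_f t); rewrite permKV.
Qed.

(** On the stabiliser of [I] the sign is a linear character, so each [h] there contributes
    [stab_sign g I] to the convolution; any other [h] contributes 0. *)
Lemma stab_sign_quasi_idempotent I : quasi_idempotent (stab_sign^~ I) #|'St(I)|%:R.
Proof.
move=> g; rewrite (bigID (mem 'St(I))) /= [X in _ + X]big1 ?addr0 => [|h nh]; last first.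
  by rewrite {1}/stab_sign (negbTE nh) mul0r.
rewrite (eq_bigr (fun=> stab_sign g I)); last first.
  by move=> h Nh; rewrite stab_signMl ?groupV // mulrA stab_signV stab_sign_sqr Nh mul1r.
by rewrite sumr_const mulr_natl.
Qed.

(** Induction on the size of [I :\: J], which drops under a transposition exchanging one of its
    elements with one of [J :\: I]. *)
Lemma perm_transitive_sets I J : #|I| = #|J| -> exists s : {perm T}, s @: I = J.
Proof.
elim: {I}_.+1 {-2}I (ltnSn #|I :\: J|) => // n IHn I; rewrite ltnS => le_n eqIJ.
have eqD : #|J :\: I| = #|I :\: J|.
  by apply/eqP; rewrite -(eqn_add2l #|I :&: J|) {1}setIC !cardsID eqIJ.
have [I0|[a]] := set_0Vmem (I :\: J).
  exists 1%g; rewrite (_ : _ @: I = I).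
    by apply/eqP; rewrite eqEcard eqIJ leqnn andbT -setD_eq0 I0.
  by rewrite -[RHS]imset_id; apply: eq_imset => x; rewrite perm1.
rewrite inE => /andP[nJa Ia].
have /card_gt0P[b] : (0 < #|J :\: I|)%N.
  by rewrite eqD; apply/card_gt0P; exists a; rewrite inE nJa.
rewrite inE => /andP[nIb Jb].
have [||s sE] := IHn (tperm a b @: I); last 2 first.
- by rewrite card_imset //; apply: perm_inj.
- by exists (tperm a b * s)%g; rewrite -sE -imset_comp; apply: eq_imset => x; rewrite /= permM.
apply: leq_trans le_n; apply: proper_card; apply/properP; split.
  apply/subsetP => _ /setDP[/imsetP[x Ix ->]]; case: tpermP => [_|xb|_ _] nJ.
  - by rewrite Jb in nJ.
  - by rewrite xb (negbTE nIb) in Ix.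
  - by rewrite inE Ix nJ.
exists a; first by rewrite inE nJa.
rewrite inE nJa /=; apply/imsetP => -[x Ix].
case: tpermP => [_ ab|xb|nxa _ /esym//]; first by rewrite ab Jb in nJa.
by rewrite xb (negbTE nIb) in Ix.
Qed.

Lemma card_perm_imset I J : #|I| = #|J| -> #|[set s : {perm T} | s @: I == J]| = #|'St(I)|.
Proof.
move=> /perm_transitive_sets[s0 <-].
rewrite -[RHS](card_imset _ (mulIg s0)); apply: eq_card => s; rewrite inE.
apply/eqP/imsetP => [sI|[t Nt ->]]; last first.
  move: Nt; rewrite stab_imset => /eqP {2}<-; rewrite -imset_comp.
  by apply: eq_imset => x; rewrite /= permM.
exists (s * s0^-1)%g; last by rewrite mulgKV.
rewrite stab_imset; apply/eqP; rewrite -[RHS](_ : s0^-1%g @: (s0 @: I) = I).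
  by rewrite -sI -imset_comp; apply: eq_imset => x; rewrite /= permM.
by rewrite -imset_comp -[RHS]imset_id; apply: eq_imset => x; rewrite /= permK.
Qed.

(* The character of the exterior power [Lambda^j] of the permutation
   representation, where [j = #|I|]. *)
Definition ext_char I := ideal_char (stab_sign^~ I).

Lemma ext_char_char I : ext_char I \is a character.
Proof. exact: ideal_char_char. Qed.

(** The trace in the basis of wedges: conjugation by [t] moves [I] to [t @: I], and each set of the
    size of [I] is reached by [#|'St(I)|] permutations [t]. *)
Lemma ext_charE I s : ext_char I s = \sum_(J : {set T} | #|J| == #|I|) stab_sign s J.
Proof.
have N0 : #|'St(I)|%:R != 0 :> algC by exact: neq0CG.
apply: (mulfI N0); rewrite (ideal_charE _ (stab_sign_quasi_idempotent I)).
transitivity (\sum_(t : {perm T}) stab_sign s (t @: I)).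
  apply: eq_bigr => t _; rewrite -(stab_signJ _ t) conjgE !mulgA mulVg mul1g mulgKV.
  by rewrite stab_signV.
rewrite (partition_big (fun t : {perm T} => t @: I) (fun J => #|J| == #|I|)) /=; last first.
  by move=> t _; rewrite card_imset //; apply: perm_inj.
rewrite mulr_sumr; apply: eq_bigr => J /eqP eqJ.
rewrite (eq_bigr (fun=> stab_sign s J)) => [|t /eqP-> //].
by rewrite sumr_const -(card_perm_imset (esym eqJ)) mulr_natl cardsE.
Qed.

(** Right multiplication by a transposition of two elements of [J :\: I] keeps the sign at [I] and
    flips the one at [J], so the sum is its own negative. *)
Lemma sum_stab_signM_eq0 I J : (1 < #|J :\: I|)%N ->
  \sum_t stab_sign t I * stab_sign t J = 0.
Proof.
case/card_gt1P => x [y []]; rewrite !inE => /andP[Ix Jx] /andP[Iy Jy] nxy.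
apply/eqP; rewrite -eqNr [X in _ == X](reindex_inj (mulIg (tperm x y))) -sumrN.
apply/eqP; apply: eq_bigr => t _.
rewrite (stab_signMr t (tperm_stab_out Ix Iy)) (stab_signMr t (tperm_stab_in Jx Jy)).
by rewrite stab_sign_tperm_out // stab_sign_tperm_in // mulr1 mulrN1 mulrN.
Qed.

(** Each of the two sets arises from [I] by exchanging one element; [s] swaps the two removed
    elements and the two added ones. *)
Lemma stab_trans_neighbours I J J' : #|J| = #|I| -> #|J'| = #|I| ->
  #|J :\: I| = 1%N -> #|J' :\: I| = 1%N -> exists2 s, s \in 'St(I) & s @: J = J'.
Proof.
move=> cJ cJ' JI J'I.
have eqD (K : {set T}) : #|K| = #|I| -> #|I :\: K| = #|K :\: I|.
  by move=> cK; apply/eqP; rewrite -(eqn_add2l #|I :&: K|) {2}setIC !cardsID cK.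
have memD (K : {set T}) a b : I :\: K = [set a] -> K :\: I = [set b] ->
    forall x, (x \in K) = (x == b) || (x \in I) && (x != a).
  move=> IK KI x; move/setP/(_ x): IK; move/setP/(_ x): KI; rewrite !inE.
  by do 4![case: (_ \in _) || case: (_ == _)].
have /cards1P[a Ea] := introT eqP (etrans (eqD _ cJ) JI).
have /cards1P[a' Ea'] := introT eqP (etrans (eqD _ cJ') J'I).
have /cards1P[b Eb] := introT eqP JI; have /cards1P[b' Eb'] := introT eqP J'I.
have memJ := memD _ _ _ Ea Eb; have memJ' := memD _ _ _ Ea' Eb'.
have Ia : a \in I by have /setDP[] : a \in I :\: J by rewrite Ea inE.
have Ia' : a' \in I by have /setDP[] : a' \in I :\: J' by rewrite Ea' inE.
have Ib : b \notin I by have /setDP[] : b \in J :\: I by rewrite Eb inE.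
have Ib' : b' \notin I by have /setDP[] : b' \in J' :\: I by rewrite Eb' inE.
exists (tperm a a' * tperm b b')%g.
  by rewrite groupM ?(tperm_stab_in Ia Ia') ?(tperm_stab_out Ib Ib').
apply/eqP; rewrite eqEcard card_imset ?cJ ?cJ' ?leqnn ?andbT; last exact: perm_inj.
apply/subsetP => _ /imsetP[x Jx ->]; rewrite permM.
have fixI z : z \in I -> tperm b b' z = z.
  by move=> Iz; rewrite tpermD //; [apply: contraNneq Ib => ->|apply: contraNneq Ib' => ->].
move: Jx; rewrite memJ => /orP[/eqP->|/andP[Ix nxa]].
  rewrite (tpermD (x := a)); first by rewrite tpermL memJ' eqxx.
    by apply: contraNneq Ib => <-.
  by apply: contraNneq Ib => <-.
case: (tpermP a a' x) => [xa|xa'|_ nxa']; first by rewrite xa eqxx in nxa.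
  by rewrite fixI // memJ' Ia -xa' [a == x]eq_sym nxa orbT.
by rewrite fixI // memJ' Ix orbC /=; case: eqP nxa'.
Qed.

(** Times [#|'St(I)|], the norm is a sum over sets [J] of the size of [I]. Those with two elements
    outside [I] contribute 0, [J = I] contributes [#|'St(I)|], and the neighbours of [I] together at
    most as much. *)
Lemma cfnorm_ext_char I : '[ext_char I] <= 2%:R.
Proof.
have N0 : 0 < #|'St(I)|%:R :> algC by rewrite ltr0n cardG_gt0.
rewrite -(ler_pM2l N0).
rewrite (cfdot_ideal_char (stab_sign_quasi_idempotent I) (ideal_char_char _)).
under eq_bigr do rewrite ext_charE mulr_sumr.
rewrite exchange_big (bigD1 I) //= mulr_natr mulr2n lerD //.
  under eq_bigr do rewrite stab_sign_sqr.
  by rewrite -natr_sum -sum1_card [in leRHS]big_mkcond /=.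
pose O := [set J : {set T} | (#|J| == #|I|) && (#|J :\: I| == 1%N)].
rewrite (bigID (mem O)) /= [X in _ + X]big1 ?addr0 => [|J /andP[/andP[cJ nJI]]]; last first.
  rewrite inE cJ /= => nJ1; apply: sum_stab_signM_eq0.
  rewrite ltn_neqAle eq_sym nJ1 lt0n cards_eq0 setD_eq0; apply: contra nJI => sJI.
  by rewrite eqEcard sJI (eqP cJ) leqnn.
apply: (@le_trans _ _ (\sum_(J in O) #|'St(I) :&: 'St(J)|%:R)).
  rewrite [leRHS]big_mkcond [leLHS]big_mkcond; apply: ler_sum => J _ /=.
  case: ifP => [/andP[_ ->]|]; last by case: ifP => // *; rewrite ler0n.
  rewrite -sum1_card natr_sum [leRHS]big_mkcond; apply: ler_sum => t _ /=.
  rewrite inE /stab_sign; case: (_ \in _); rewrite ?mul0r //=.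
  case: (_ \in _); rewrite ?mulr0 // -signr_addb; case: (_ (+) _) => //.
  by rewrite expr1 (le_trans (lerN10 _)) ?ler01.
have [O0|[J0 J0O]] := set_0Vmem O; first by rewrite O0 big_set0 ler0n.
rewrite -natr_sum ler_nat.
(* [O] lies in one orbit of ['St(I)], so [#|O|] times the order of the stabiliser of any [J] in [O]
   is at most [#|'St(I)|]; this is summed over [O]. *)
rewrite -(leq_pmul2l (m := #|O|)); last by apply/card_gt0P; exists J0.
rewrite big_distrr /= -sum_nat_const; apply: leq_sum => J JO.
rewrite -[X in (_ <= X)%N](card_orbit_stab ('P^*)%act 'St(I) J).
have -> : (#|'C_('St(I))[J | ('P^*)%act]| = #|'St(I) :&: 'St(J)|)%g.
  by rewrite astab1_set.
rewrite leq_mul2r; apply/orP; right; apply: subset_leq_card; apply/subsetP => J'.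
move: JO; rewrite !inE => /andP[/eqP cJ /eqP cJI] /andP[/eqP cJ' /eqP cJI'].
have [s Ns sJ] := stab_trans_neighbours cJ cJ' cJI cJI'.
by apply/orbitP; exists s => //; rewrite -sJ.
Qed.

End StabSign.

(** * Cycle products as generating functions of stable sets *)

Section PorbitPolynomial.

Variable (T : finType) (s : {perm T}).
Implicit Types (I c : {set T}) (J : {set {set T}}) (x y : T).
Local Notation "''St' ( I )" := ('N(I | 'P))%g (format "''St' ( I )").

Lemma stab_permX I i x : s \in 'St(I) -> ((s ^+ i)%g x \in I) = (x \in I).
Proof. by move=> Ns; apply: stabP; apply: groupX. Qed.

Lemma porbits_trivIset : trivIset (porbits s).
Proof.
apply/trivIsetP => _ _ /imsetP[x _ ->] /imsetP[y _ ->] nxy.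
rewrite -setI_eq0; apply: contraNT nxy => /set0Pn[z /setIP[zx zy]].
by rewrite -(eqP (etrans (eq_porbit_mem _ _ _) zx)) eq_porbit_mem.
Qed.

Lemma porbit_in_porbits x : porbit s x \in porbits s.
Proof. exact: imset_f. Qed.

Lemma mem_porbitsE c x : c \in porbits s -> x \in c -> c = porbit s x.
Proof. by case/imsetP=> y _ -> xy; apply/esym/eqP; rewrite eq_porbit_mem. Qed.

Lemma porbit_sub_stab I x : s \in 'St(I) -> (porbit s x \subset I) = (x \in I).
Proof.
move=> Ns; apply/idP/idP => [/subsetP->|Ix]; first by []; first exact: porbit_id.
by apply/subsetP => _ /porbitP[i ->]; rewrite stab_permX.
Qed.

Definition porbits_in I := [set c in porbits s | c \subset I].

Lemma cover_porbits_in I : s \in 'St(I) -> cover (porbits_in I) = I.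
Proof.
move=> Ns; apply/setP => x; apply/bigcupP/idP => [[c]|Ix].
  by rewrite inE => /andP[_ /subsetP sI]; apply: sI.
by exists (porbit s x); rewrite ?porbit_id // inE porbit_in_porbits porbit_sub_stab.
Qed.

Lemma cover_stab J : J \subset porbits s -> s \in 'St(cover J).
Proof.
have sx x : s x \in porbit s x by have := mem_porbit s 1 x; rewrite expg1.
move/subsetP=> sJ; apply/stabP => x; apply/bigcupP/bigcupP => -[c cJ xc]; exists c => //.
  by rewrite (mem_porbitsE (sJ _ cJ) xc) porbit_sym.
by rewrite (mem_porbitsE (sJ _ cJ) xc).
Qed.

Lemma porbits_in_cover J : J \subset porbits s -> porbits_in (cover J) = J.
Proof.
move=> sJ; apply/setP => c; rewrite inE; apply/andP/idP => [[cP cJ]|cJ]; last first.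
  by split; [apply: (subsetP sJ)|apply: bigcup_sup].
have [x _ cE] := imsetP cP; have xc : x \in c by rewrite cE porbit_id.
have /bigcupP[c' c'J xc'] := subsetP cJ _ xc.
by rewrite (mem_porbitsE cP xc) -(mem_porbitsE (subsetP sJ _ c'J) xc').
Qed.

Lemma porbits_restr_perm I : s \in 'St(I) ->
  porbits (restr_perm I s) = porbits_in I :|: [set [set x] | x in ~: I].
Proof.
move=> Ns; set t := restr_perm I s.
have tX i x : x \in I -> (t ^+ i)%g x = (s ^+ i)%g x.
  move=> Ix; elim: i => [|i IHi]; first by rewrite !expg0.
  by rewrite !expgSr !permM IHi restr_permE // stab_permX.
have tN i x : x \notin I -> (t ^+ i)%g x = x.
  move=> Ix; elim: i => [|i IHi]; first by rewrite expg0 perm1.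
  by rewrite expgSr permM IHi (out_perm (restr_perm_on _ _)).
have tI x : x \in I -> porbit t x = porbit s x.
  by move=> Ix; apply/setP => y; apply/porbitP/porbitP => -[i ->]; exists i; rewrite tX.
have tO x : x \notin I -> porbit t x = [set x].
  move=> Ix; apply/setP => y; rewrite inE; apply/porbitP/eqP => [[i ->]|->]; first by rewrite tN.
  by exists 0%N; rewrite expg0 perm1.
apply/setP => c; apply/imsetP/setUP => [[x _ ->]|[]].
- have [Ix|Ix] := boolP (x \in I).
    by left; rewrite tI // inE porbit_in_porbits porbit_sub_stab.
  by right; rewrite tO //; apply: imset_f; rewrite inE.
- rewrite inE => /andP[/imsetP[x _ ->]]; rewrite porbit_sub_stab // => Ix.
  by exists x; rewrite // tI.
- by case/imsetP=> x; rewrite inE => Ix ->; exists x; rewrite // tO.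
Qed.

(** The cycles of the restriction are those of [s] inside [I] and one fixed point per element
    outside; the sign is the parity of points plus cycles. *)
Lemma stab_sign_porbits I : s \in 'St(I) ->
  stab_sign s I = (-1) ^+ (#|I| + #|porbits_in I|).
Proof.
move=> Ns; rewrite /stab_sign Ns /odd_perm porbits_restr_perm //.
rewrite cardsU (_ : _ :&: _ = set0) ?cards0 ?subn0; last first.
  apply/setP => c; rewrite !inE; apply/negP => /andP[/andP[_ sI] /imsetP[x]].
  by rewrite inE => /negP Ix cE; apply/Ix/(subsetP sI); rewrite cE set11.
rewrite (card_imset _ set1_inj) -(cardsC I) -[RHS]signr_odd !oddD.
congr ((-1) ^+ nat_of_bool _).
by move: (odd #|I|) (odd #|~: I|) (odd #|porbits_in I|) => [] [] [].
Qed.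

(** Stable sets are unions of cycles, and the two factors [(-1)^|I|] cancel, so a set of cycles
    contributes the product of its [- 'X^#|c|]. *)
Lemma sum_stab_sign :
  \sum_(I : {set T}) stab_sign s I *: (- 'X) ^+ #|I|
    = \prod_(c in porbits s) (1 - 'X^#|c|) :> {poly algC}.
Proof.
rewrite (bigID (fun I => s \in 'St(I))) /= [X in _ + X]big1 ?addr0 => [|I nI]; last first.
  by rewrite /stab_sign (negbTE nI) scale0r.
rewrite (reindex_onto cover porbits_in) /=; last by move=> I; apply: cover_porbits_in.
rewrite big_mkcond [RHS](eq_bigr (fun c : {set T} => - 'X^#|c| + 1)); last by move=> c _; rewrite addrC.
rewrite [RHS]big_mkcond /=.
(* Sets that are not cycles get the factor [0 + 1], so the expansion over all sets of subsets keeps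
   only sets of cycles. *)
rewrite [RHS](eq_bigr (fun c : {set T} => (if c \in porbits s then - 'X^#|c| else 0) + 1)); last first.
  by move=> c _; case: ifP; rewrite ?add0r.
rewrite bigA_distr; apply: eq_big => // J _.
have [sJ|nsJ] := boolP (J \subset porbits s); last first.
  have [c cJ cP] := subsetPn nsJ.
  rewrite [RHS](bigD1 c) //= cJ (negbTE cP) mul0r.
  case: ifP => // /andP[NJ /eqP JE]; case/negP: nsJ; rewrite -JE.
  by apply/subsetP => c'; rewrite inE => /andP[].
have NJ := cover_stab sJ.
rewrite NJ porbits_in_cover // eqxx /= stab_sign_porbits // porbits_in_cover //.
rewrite -(eqP (trivIsetS sJ porbits_trivIset)).
rewrite -[RHS]big_mkcond /= (eq_bigr (fun c : {set T} => - 'X^#|c|)); last first.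
  by move=> c cJ; rewrite (subsetP sJ).
rewrite prodrN prodrXr -mul_polyC rmorph_sign [(- 'X) ^+ _]exprNn mulrA -exprD addnAC addnn.
by rewrite exprD -mul2n exprM sqrrN !expr1n mul1r.
Qed.

Lemma porbit_poly_root1 (x : T) :
  (\prod_(c in porbits s) (1 - 'X^#|c|) : {poly algC}).[1] = 0.
Proof.
rewrite horner_prod (bigD1 (porbit s x)) ?porbit_in_porbits //=.
by rewrite (_ : (1 - 'X^_).[1] = 0) ?mul0r // !hornerE expr1n subrr.
Qed.

End PorbitPolynomial.

(** * Young symmetrizers *)

Section YoungSymmetrizer.

(** An abstract tableau: [rw] and [cl] give the position of a box, [box] the box at a position, [l]
    the row lengths, and [m] bounds the row indices. *)
Variables (d m : nat) (rw cl : 'I_d -> nat) (l : nat -> nat) (box : nat -> nat -> 'I_d).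
Hypothesis box_inj : forall x y, rw x = rw y -> cl x = cl y -> x = y.
Hypothesis cl_lt : forall x, (cl x < l (rw x))%N.
Hypothesis rw_lt : forall x, (rw x < m)%N.
Hypothesis rw_box : forall i j, (j < l i)%N -> rw (box i j) = i.
Hypothesis cl_box : forall i j, (j < l i)%N -> cl (box i j) = j.
Implicit Types (I J : {set 'I_d}) (p q g : 'S_d) (F : 'S_d -> algC).

Definition level_stab (u : 'I_d -> nat) : {set 'S_d} := [set p : 'S_d | [forall k, u (p k) == u k]].

Lemma level_stabP u p : reflect (forall k, u (p k) = u k) (p \in level_stab u).
Proof. by rewrite inE; apply: 'forall_eqP. Qed.

Lemma level_stab1 u : 1%g \in level_stab u.
Proof. by apply/level_stabP => k; rewrite perm1. Qed.

Lemma level_stabV u p : p \in level_stab u -> (p^-1)%g \in level_stab u.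
Proof.
by move/level_stabP=> up; apply/level_stabP => k; rewrite -{2}(permKV p k) up.
Qed.

Lemma level_stabM u p q : p \in level_stab u -> q \in level_stab u -> (p * q)%g \in level_stab u.
Proof.
by move=> /level_stabP up /level_stabP uq; apply/level_stabP => k; rewrite permM uq up.
Qed.

Lemma level_stab_tperm u x y : u x = u y -> tperm x y \in level_stab u.
Proof. by move=> uxy; apply/level_stabP => k; case: tpermP => [->|->|]. Qed.

Local Notation R := (level_stab rw).
Local Notation C := (level_stab cl).

(* The number of boxes sent to the first [j] columns is the number of boxes in
   these columns, while in each row at most as many boxes are sent there as are
   there; so equality holds in each row, and row [i] is sent to the first
   [l i] columns. *)
Lemma cl_perm_lt g : (forall x y, rw x = rw y -> cl (g x) = cl (g y) -> x = y) ->
  forall x, (cl (g x) < l (rw x))%N.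
Proof.
move=> sep x; set j := l (rw x).
pose A i := [set y | (rw y == i) && (cl (g y) < j)%N].
pose B i := [set y | (rw y == i) && (cl y < j)%N].
have leAB i : (#|A i| <= #|B i|)%N.
  have [lej|ltj] := leqP j (l i).
    rewrite -(card_in_imset (f := fun y => box i (cl (g y)))).
      apply: subset_leq_card; apply/subsetP => z /imsetP[y].
      rewrite inE => /andP[_ ltcj] ->; have ltcl := leq_trans ltcj lej.
      by rewrite inE rw_box // cl_box // eqxx.
    move=> y z; rewrite !inE => /andP[/eqP ry cy] /andP[/eqP rz cz] /(congr1 cl).
    rewrite !cl_box ?(leq_trans _ lej) //; apply: sep; congruence.
  apply: subset_leq_card; apply/subsetP => y; rewrite !inE => /andP[/eqP ry _].
  by rewrite ry eqxx (leq_trans (cl_lt y)) // ry ltnW.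
have cardrows (h : 'S_d) : (\sum_(i < m) #|[set y | (rw y == i) && (cl (h y) < j)]|
                   = #|[set y | cl y < j]|)%N.
  have -> : #|[set y | (cl y < j)%N]| = #|[set y | (cl (h y) < j)%N]|.
    rewrite -(card_preimset [set y | (cl y < j)%N] (@perm_inj _ h)); apply: eq_card => y.
    by rewrite !inE.
  rewrite -[RHS]sum1_card (partition_big (fun y => Ordinal (rw_lt y)) predT) //=.
  apply: eq_bigr => i _; rewrite -sum1_card; apply: eq_bigl => y.
  by rewrite !inE andbC.
have := leqif_sum (fun (i : 'I_m) (_ : true) => leqif_eq (leAB i)).
case=> _; have -> : (\sum_(i < m) #|B i| = \sum_(i < m) #|A i|)%N.
  rewrite (cardrows g) -(cardrows 1%g); apply: eq_bigr => i _.
  by apply: eq_card => y; rewrite !inE perm1.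
rewrite eqxx => /esym/forallP/(_ (Ordinal (rw_lt x)))/= eqAB.
have sAB : A (rw x) \subset B (rw x).
  by apply/subsetP => y; rewrite !inE => /andP[/eqP ry _]; rewrite ry eqxx /j -ry cl_lt.
have /eqP eqc : A (rw x) == B (rw x) by rewrite eqEcard sAB (eqP eqAB) /=.
have : x \in B (rw x) by rewrite inE eqxx cl_lt.
by rewrite -eqc inE eqxx.
Qed.

(** [p] moves [x] within its row to the column of [g x], where [cl_perm_lt] guarantees a box; the
    remaining [p^-1 * g] preserves columns. *)
Lemma young_factor g : (forall x y, rw x = rw y -> cl (g x) = cl (g y) -> x = y) ->
  exists p q, [/\ p \in R, q \in C & g = (p * q)%g].
Proof.
move=> sep; have lt := cl_perm_lt sep.
pose f x := box (rw x) (cl (g x)).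
have f_inj : injective f.
  move=> x y fxy; have := congr1 rw fxy; have := congr1 cl fxy.
  by rewrite !rw_box ?cl_box // => ? ?; apply: sep.
exists (perm f_inj), ((perm f_inj)^-1 * g)%g; split; last by rewrite mulKVg.
  by apply/level_stabP => x; rewrite permE rw_box.
apply/level_stabP => y; rewrite permM -{2}(permKV (perm f_inj) y).
by rewrite permE cl_box.
Qed.

Lemma young_dichotomy g : (exists p q, [/\ p \in R, q \in C & g = (p * q)%g]) \/
  (exists x y, [/\ x != y, rw x = rw y & cl (g x) = cl (g y)]).
Proof.
have [/existsP[x /existsP[y /and3P[? /eqP ? /eqP ?]]]|] :=
  boolP [exists x, exists y, [&& x != y, rw x == rw y & cl (g x) == cl (g y)]].
  by right; exists x, y.
move=> nex; left; apply: young_factor => x y rxy cxy; apply/eqP.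
apply: contraNT nex => nxy; apply/existsP; exists x; apply/existsP; exists y.
by rewrite nxy rxy cxy !eqxx.
Qed.

Definition young_elt g : algC :=
  \sum_(p in R) \sum_(q in C) (-1) ^+ odd_perm q * (p * q == g)%g%:R.

Definition young_equivariant F :=
  forall p q g, p \in R -> q \in C -> F (p * g * q)%g = (-1) ^+ odd_perm q * F g.

Lemma sum_young_elt F :
  \sum_g young_elt g * F g
    = \sum_(p in R) \sum_(q in C) (-1) ^+ odd_perm q * F (p * q)%g.
Proof.
under eq_bigr do rewrite mulr_suml.
rewrite exchange_big; apply: eq_bigr => p _ /=.
under eq_bigr do rewrite mulr_suml.
rewrite exchange_big; apply: eq_bigr => q _ /=.
rewrite (bigD1 (p * q)%g) //= eqxx mulr1 big1 ?addr0 // => g /negbTE.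
by rewrite eq_sym => ->; rewrite mulr0 mul0r.
Qed.

Lemma young_elt1 : young_elt 1%g = 1.
Proof.
rewrite /young_elt (bigD1 1%g) ?level_stab1 //= (bigD1 1%g) ?level_stab1 //= mul1g eqxx odd_perm1 mul1r.
rewrite !big1 ?addr0 // => [p /andP[/level_stabP Rp p1]|q /andP[_ /negbTE q1]]; last first.
  by rewrite mul1g q1 mulr0.
rewrite big1 // => q /level_stabP Cq; rewrite [_ == _](negbTE _) ?mulr0 //.
apply: contra p1 => /eqP pq; apply/eqP/permP => x; rewrite perm1.
apply: box_inj; first exact: Rp.
by rewrite -Cq -permM pq perm1.
Qed.

Lemma young_elt_equivariant : young_equivariant young_elt.
Proof.
move=> p q g Rp Cq; rewrite /young_elt mulr_sumr.
rewrite (reindex_inj (mulgI p)); apply: eq_big => [p'|p' _] /=.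
  apply/idP/idP => [Rpp|]; last exact: level_stabM.
  by rewrite -(mulKg p p'); apply: level_stabM (level_stabV Rp) Rpp.
rewrite mulr_sumr (reindex_inj (mulIg q)); apply: eq_big => [q'|q' _] /=.
  apply/idP/idP => [Cqq|Cq']; last exact: level_stabM.
  by rewrite -(mulgK q q'); apply: level_stabM Cqq (level_stabV Cq).
rewrite odd_permM signr_addb -mulrA mulrCA; congr (_ * (_ * _%:R)).
by rewrite !mulgA (inj_eq (mulIg q)) -!mulgA (inj_eq (mulgI p)).
Qed.

(** On products [p * q] equivariance determines [F] from [F 1]; any other [g] sends two boxes of one
    row into one column, which forces [F g = 0]. *)
Lemma young_equivariantE F : young_equivariant F ->
  forall g, F g = F 1%g * young_elt g.
Proof.
move=> Fe g; case: (young_dichotomy g) => [[p [q [Rp Cq ->]]]|[x [y [nxy rxy cxy]]]].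
  rewrite -[p]mulg1 Fe // young_elt_equivariant // young_elt1 mulr1.
  by rewrite mulrC.
(* For [p = tperm x y] and [q = tperm (g x) (g y)] the product [p * g * q] is [g] again, while [q]
   is odd. *)
have vanish F' : young_equivariant F' -> F' g = 0.
  move=> Fe'; have := Fe' (tperm x y) (tperm (g x) (g y)) g.
  rewrite !level_stab_tperm // odd_tperm (inj_eq perm_inj) nxy expr1 mulN1r.
  move=> /(_ isT isT)/esym; rewrite -tpermJ conjgE !mulgA mulgK tperm2 mul1g.
  by move/eqP; rewrite eqNr => /eqP.
by rewrite (vanish _ Fe) (vanish _ young_elt_equivariant) mulr0.
Qed.

Definition young_norm := \sum_h young_elt h * young_elt (h^-1)%g.

(** For the symmetrizer [e], the left side is the coefficient of [e x^-1 e] at [g]. It is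
    equivariant in [g], hence a multiple of [e]. *)
Lemma young_convE x g : \sum_h young_elt h * young_elt (x * h^-1 * g)%g
   = (\sum_h young_elt h * young_elt (x * h^-1)%g) * young_elt g.
Proof.
pose F g := \sum_h young_elt h * young_elt (x * h^-1 * g)%g.
rewrite -/(F g) young_equivariantE => [|p q g' Rp Cq].
  by congr (_ * _); apply: eq_bigr => h _; rewrite mulg1.
rewrite /F mulr_sumr (reindex_inj (mulgI p)); apply: eq_bigr => h _ /=.
rewrite -[(p * h)%g]mulg1 young_elt_equivariant ?level_stab1 // odd_perm1 mul1r.
rewrite mulrCA -(young_elt_equivariant _ (level_stab1 rw) Cq); congr (_ * young_elt _).
by rewrite mulg1 mul1g invMg !mulgA mulgKV.
Qed.

Lemma young_quasi_idempotent : quasi_idempotent young_elt young_norm.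
Proof.
move=> g; have := young_convE 1%g g.
under eq_bigr do rewrite mul1g; move=> ->.
by under eq_bigr do rewrite mul1g.
Qed.

(** By [ideal_char1], [young_norm] times a dimension is the group order, since the coefficient at
    the identity is 1. *)
Lemma young_norm_neq0 : young_norm != 0.
Proof.
have := ideal_char1 young_quasi_idempotent; rewrite young_elt1 mulr1.
apply: contra_eq_neq => ->; rewrite mul0r eq_sym pnatr_eq0 -lt0n.
by apply/card_gt0P; exists 1%g.
Qed.

(** The pairing and trace formulas turn [young_norm ^+ 2] times the norm of the character into
    [young_norm] times the sum of [young_elt x * young_elt x^-1], which is [young_norm ^+ 2]. *)
Lemma young_ideal_irr : ideal_char young_elt \in irr [set: 'S_d]%G.
Proof.
set chi := ideal_char _.
rewrite irrEchar ideal_char_char /=; apply/eqP.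
have n0 := young_norm_neq0; apply: (mulfI n0); apply: (mulfI n0).
rewrite (cfdot_ideal_char young_quasi_idempotent (ideal_char_char _)).
rewrite mulr_sumr.
under eq_bigr do rewrite mulrCA (ideal_charE _ young_quasi_idempotent) mulr_sumr.
rewrite exchange_big /=.
transitivity (\sum_x (young_norm * young_elt x) * young_elt x^-1%g).
  apply: eq_bigr => x _; rewrite -young_quasi_idempotent.
  rewrite young_convE; congr (_ * _).
  rewrite (reindex_inj (@invg_inj _)) (reindex_inj (mulgI x^-1)%g) /=.
  by apply: eq_bigr => h _; rewrite invgK mulKVg invMg invgK mulrC.
rewrite mulr1; under eq_bigr do rewrite -mulrA.
by rewrite -mulr_sumr.
Qed.

Definition young_weight (I : {set 'I_d}) : algC :=
  \sum_(p in R) \sum_(q in C) (-1) ^+ odd_perm q * stab_sign (p * q)%g I.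

(** Left multiplication of [p] by [tperm x y] stays in the row stabiliser and flips the sign on
    [I]. *)
Lemma young_weight_row I x y : x \in I -> y \in I -> x != y -> rw x = rw y ->
  young_weight I = 0.
Proof.
move=> Ix Iy nxy rxy; have Rt := level_stab_tperm rxy.
apply/eqP; rewrite -eqNr -sumrN [X in _ == X](reindex_inj (mulgI (tperm x y))).
apply/eqP; apply: eq_big => [p|p _] /=.
  apply/idP/idP => [Rp|Rtp]; first exact: level_stabM.
  by rewrite -[p](mulKg (tperm x y)) tpermV; apply: level_stabM.
rewrite -sumrN; apply: eq_bigr => q _.
rewrite -mulgA (stab_signMl _ (tperm_stab_in Ix Iy)) stab_sign_tperm_in //.
by rewrite mulN1r mulrN.
Qed.

(** Right multiplication of [q] by [tperm x y] flips the sign of [q] but not the sign on [I]. *)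
Lemma young_weight_col I x y : x \notin I -> y \notin I -> x != y -> cl x = cl y ->
  young_weight I = 0.
Proof.
move=> Ix Iy nxy cxy; have Ct := level_stab_tperm cxy.
apply/eqP; rewrite -eqNr -sumrN; apply/eqP; apply: eq_bigr => p _ /=.
rewrite -sumrN [RHS](reindex_inj (mulIg (tperm x y))).
apply: eq_big => [q|q _] /=.
  apply/idP/idP => [Cq|Cqt]; first exact: level_stabM.
  by rewrite -[q](mulgK (tperm x y)) tpermV; apply: level_stabM.
rewrite mulgA (stab_signMr _ (tperm_stab_out Ix Iy)) stab_sign_tperm_out //.
by rewrite mulr1 odd_permM odd_tperm nxy addbT signrN mulNr.
Qed.

Lemma young_weight_neq0_row I : young_weight I != 0 -> {in I &, injective rw}.
Proof.
move=> W0 x y Ix Iy rxy; apply/eqP; apply: contraNT W0 => nxy.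
by rewrite (young_weight_row Ix Iy).
Qed.

Lemma young_weight_neq0_col I : young_weight I != 0 -> {in ~: I &, injective cl}.
Proof.
move=> W0 x y; rewrite !inE => Ix Iy cxy; apply/eqP; apply: contraNT W0 => nxy.
by rewrite (young_weight_col Ix Iy).
Qed.

Lemma leq_card_level (u : 'I_d -> nat) n (I : {set 'I_d}) :
  (forall x, (u x < n)%N) -> {in I &, injective u} -> (#|I| <= n)%N.
Proof.
move=> lt_un inj; pose f x := Ordinal (lt_un x).
rewrite -[X in (_ <= X)%N]card_ord -(card_in_imset (f := f)) ?max_card //.
by move=> x y Ix Iy /(congr1 val); apply: inj.
Qed.

(** [I] meets each row at most once, and its complement meets each column at most once. *)
Lemma young_weight_neq0_card n I : (forall x, (cl x < n)%N) -> young_weight I != 0 ->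
  (#|I| <= m)%N && (d <= #|I| + n)%N.
Proof.
move=> ltn W0; rewrite (leq_card_level rw_lt (young_weight_neq0_row W0)) /=.
have := leq_card_level ltn (young_weight_neq0_col W0).
move=> leC; apply: leq_trans (_ : #|I| + #|~: I| <= _)%N; last by rewrite leq_add2l.
by rewrite cardsC card_ord.
Qed.

Definition young_pairing j := \sum_(J : {set 'I_d} | #|J| == j) young_weight J.

Lemma cfdot_young_ext I :
  young_norm * '[ideal_char young_elt, ext_char I] = young_pairing #|I|.
Proof.
rewrite (cfdot_ideal_char young_quasi_idempotent (ideal_char_char _)) sum_young_elt.
rewrite [RHS]exchange_big; apply: eq_bigr => p _ /=.
rewrite [RHS]exchange_big; apply: eq_bigr => q _ /=.
by rewrite ext_charE mulr_sumr.
Qed.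

(** The generating function [sum_stab_sign] vanishes at 1, because each factor [1 - 'X^#|c|]
    does. *)
Lemma alternating_young_weight : (0 < d)%N ->
  \sum_(J : {set 'I_d}) young_weight J * (-1) ^+ #|J| = 0.
Proof.
move=> d_gt0; under eq_bigr do rewrite mulr_suml.
rewrite exchange_big big1 // => p _ /=.
under eq_bigr do rewrite mulr_suml.
rewrite exchange_big big1 // => q _ /=.
under eq_bigr do rewrite -mulrA.
rewrite -mulr_sumr.
have /(congr1 (horner^~ 1)) /= := sum_stab_sign (p * q)%g.
rewrite horner_sum (eq_bigr (fun J : {set 'I_d} => stab_sign (p * q)%g J * (-1) ^+ #|J|)).
  by move=> ->; rewrite (porbit_poly_root1 _ (Ordinal d_gt0)) mulr0.
by move=> J _; rewrite hornerZ horner_exp hornerN hornerX.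
Qed.

Lemma young_pairing_neq0 n j : (forall x, (cl x < n)%N) -> young_pairing j != 0 ->
  (j <= m)%N && (d <= j + n)%N.
Proof.
move=> ltn; apply: contraNT => nj; rewrite /young_pairing big1 // => J /eqP cJ.
by apply: contraNeq nj => /(young_weight_neq0_card ltn); rewrite cJ.
Qed.

Lemma alternating_young_pairing : (0 < d)%N ->
  \sum_(j < d.+1) young_pairing j * (-1) ^+ j = 0.
Proof.
move=> d_gt0; rewrite -[RHS](alternating_young_weight d_gt0).
have lt (J : {set 'I_d}) : (#|J| < d.+1)%N by rewrite ltnS -[X in (_ <= X)%N]card_ord max_card.
rewrite [RHS](partition_big (fun J : {set 'I_d} => Ordinal (lt J)) predT) //=.
apply: eq_bigr => j _; rewrite mulr_suml; apply: eq_big => [J|J /eqP->] //.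
Qed.

(** The size bounds leave only [j = m], so the alternating sum has a single term, which must
    vanish. *)
Lemma young_nonhook_pairing n j : (0 < d)%N -> (forall x, (cl x < n)%N) -> (m + n <= d)%N ->
  young_pairing j = 0.
Proof.
move=> d_gt0 ltn le_d; apply: contraTeq isT => nz.
have only i : young_pairing i != 0 -> i = m.
  case/(young_pairing_neq0 ltn)/andP => le_im le_di; apply/eqP.
  by rewrite eqn_leq le_im -(leq_add2r n) (leq_trans le_d).
have jm := only _ nz; rewrite jm in nz.
have md : (m < d.+1)%N by rewrite ltnS (leq_trans _ le_d) ?leq_addr.
have := alternating_young_pairing d_gt0.
rewrite (bigD1 (Ordinal md)) //= big1 => [|i nim]; last first.
  have [->|/only im] := eqVneq (young_pairing i) 0; first by rewrite mul0r.
  by case/eqP: nim; apply/val_inj.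
by rewrite addr0 => /eqP; rewrite mulf_eq0 signr_eq0 orbF (negbTE nz).
Qed.

(* Where all boxes lie in the first row or the first column, the nonzero terms
   of [young_weight J] with [#|J| = m] are all positive, as [p * q] then acts on
   [J] as [q] does. *)
Section Hook.

Hypothesis hook : forall x, rw x = 0%N \/ cl x = 0%N.

Lemma hook_row p x : p \in R -> rw x <> 0%N -> p x = x.
Proof.
move=> /level_stabP Rp rx; apply: box_inj; first exact: Rp.
by have := hook x; have := hook (p x); rewrite Rp => -[//|->] [//|->].
Qed.

Lemma hook_col q x : q \in C -> cl x <> 0%N -> q x = x.
Proof.
move=> /level_stabP Cq cx; apply: box_inj; last exact: Cq.
by have := hook x; have := hook (q x); rewrite Cq => -[->|//] [->|//].
Qed.

Lemma hook_stab_sign p q (J : {set 'I_d}) : (0 < m)%N -> #|J| = m -> {in J &, injective rw} ->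
  p \in R -> q \in C -> (p * q)%g \in ('N(J | 'P))%g ->
  stab_sign (p * q)%g J = (-1) ^+ odd_perm q.
Proof.
move=> m_gt0 cJ rwJ Rp Cq Npq; rewrite /stab_sign Npq; congr ((-1) ^+ odd_perm _).
(* [J] has [m] elements in distinct rows, so it meets every row. *)
have hitJ i : (i < m)%N -> exists2 x, x \in J & rw x = i.
  move=> lt_im; pose f x := Ordinal (rw_lt x).
  have fJ : f @: J = setT.
    apply/eqP; rewrite eqEcard subsetT /= cardsT card_ord card_in_imset ?cJ //.
    by move=> x y Jx Jy /(congr1 val); apply: rwJ.
  have /imsetP[x Jx /(congr1 val) /= ->] : Ordinal lt_im \in f @: J by rewrite fJ.
  by exists x.
have pqJ x : x \in J -> q (p x) \in J by move=> Jx; rewrite -permM (stabP _ _ Npq).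
have [x0 Jx0 rx0] := hitJ 0%N m_gt0.
have rowsJ x : cl x = 0%N -> rw x <> 0%N -> x \in J.
  move=> cx rx; have [y Jy ry] := hitJ _ (rw_lt x).
  suff -> : x = y by [].
  apply: box_inj => //; rewrite cx; case: (hook y) => // ry0.
  by rewrite ry0 in ry; rewrite -ry in rx.
have rwq x : rw (p x) = rw x by apply: level_stabP.
have clq x : cl (q x) = cl x by apply: level_stabP.
(* [J] contains every box of the first column below the corner. If its box [x0] in the first row is
   the corner, then [J] is the first column. *)
have [cx0|/eqP cx0] := eqVneq (cl x0) 0%N.
  have memJ x : (x \in J) = (cl x == 0%N).
    apply/idP/eqP => [Jx|cx].
      by case: (hook x) => // rx; rewrite (_ : x = x0) //; apply: rwJ; rewrite ?rx.
    case: (eqVneq (rw x) 0%N) => [rx|/eqP rx]; last exact: rowsJ.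
    by rewrite (_ : x = x0) //; apply: box_inj; rewrite ?rx ?cx.
  apply: restr_perm_eq => // [x Jx|x]; last by rewrite memJ => /eqP cx; apply: hook_col.
  rewrite permM; congr (q _).
  case: (eqVneq (rw x) 0%N) => [rx|/eqP rx]; last exact: hook_row.
  have := pqJ _ Jx; rewrite memJ clq => /eqP cpx.
  by move: Jx; rewrite memJ => /eqP cx; apply: box_inj; rewrite ?rwq ?cx.
have l0 : (0 < l 0)%N by have := cl_lt x0; rewrite rx0; apply: leq_ltn_trans.
set c := box 0 0; have rc : rw c = 0%N by apply: rw_box.
have cc : cl c = 0%N by apply: cl_box.
have nJc : c \notin J.
  by apply/negP => Jc; apply: cx0; rewrite (rwJ _ _ Jx0 Jc) ?rx0 ?rc.
have isc x : rw x = 0%N -> cl x = 0%N -> x = c by move=> rx cx; apply: box_inj; rewrite ?rc ?cc.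
(* Otherwise the preimage [z] of the corner lies below it in the first column, hence in [J], and is
   fixed by [p]; then [q (p z) = c] would lie in [J]. *)
have qc : q c = c.
  apply/eqP; apply: contraNT nJc => nqc.
  pose z := (q^-1)%g c; have qz : q z = c by rewrite permKV.
  have cz : cl z = 0%N by rewrite -clq qz.
  case: (eqVneq (rw z) 0%N) => [rz|/eqP rz].
    by rewrite (isc z) // in qz; rewrite qz eqxx in nqc.
  by rewrite -qz -(hook_row Rp rz); apply/pqJ/rowsJ.
apply: restr_perm_eq => // [x Jx|x nJx].
  rewrite permM; congr (q _).
  case: (eqVneq (rw x) 0%N) => [rx|/eqP rx]; last exact: hook_row.
  have := pqJ _ Jx; case: (eqVneq (cl (p x)) 0%N) => [cpx|/eqP cpx].
    by rewrite (isc (p x)) ?rwq // qc (negbTE nJc).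
  by rewrite (hook_col Cq cpx) => Jpx; apply: rwJ.
case: (eqVneq (cl x) 0%N) => [cx|/eqP cx]; last exact: hook_col.
case: (eqVneq (rw x) 0%N) => [rx|/eqP rx]; first by rewrite (isc x).
by rewrite rowsJ in nJx.
Qed.

Lemma hook_young_term_ge0 p q J : (0 < m)%N -> #|J| = m -> {in J &, injective rw} ->
  p \in R -> q \in C -> 0 <= (-1) ^+ odd_perm q * stab_sign (p * q)%g J.
Proof.
move=> m_gt0 cJ rwJ Rp Cq; have [Npq|Npq] := boolP ((p * q)%g \in ('N(J | 'P))%g).
  by rewrite hook_stab_sign // -expr2 sqrr_sign ler01.
by rewrite /stab_sign (negbTE Npq) mulr0.
Qed.

Lemma hook_young_weight_ge0 J : (0 < m)%N -> #|J| = m -> 0 <= young_weight J.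
Proof.
move=> m_gt0 cJ.
have [->|/young_weight_neq0_row rwJ] := eqVneq (young_weight J) 0; first by [].
by apply: sumr_ge0 => p Rp; apply: sumr_ge0 => q; apply: hook_young_term_ge0.
Qed.

(** No term is negative, and the identity contributes 1 when [J] is the first column. *)
Lemma hook_young_pairing_gt0 : (forall i, (i < m)%N -> (0 < l i)%N) -> (0 < m)%N ->
  0 < young_pairing m.
Proof.
move=> l_gt0 m_gt0; pose J := [set x | cl x == 0%N].
have rwJ : {in J &, injective rw}.
  by move=> x y; rewrite !inE => /eqP cx /eqP cy rxy; apply: box_inj; rewrite ?cx.
have cJ : #|J| = m.
  apply/eqP; rewrite eqn_leq (leq_card_level rw_lt rwJ) -{1}(card_ord m).
  rewrite -(card_imset (f := fun i : 'I_m => box i 0)) => [|i j /(congr1 rw)]; last first.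
    by rewrite !rw_box ?l_gt0 // => /val_inj.
  by apply: subset_leq_card; apply/subsetP => _ /imsetP[i _ ->]; rewrite inE cl_box ?l_gt0.
rewrite /young_pairing (bigD1 J) ?cJ ?eqxx //= ltr_wpDr //.
  by apply: sumr_ge0 => K /andP[/eqP cK _]; apply: hook_young_weight_ge0.
rewrite /young_weight (bigD1 1%g) ?level_stab1 //= ltr_wpDr //.
  by apply: sumr_ge0 => p /andP[Rp _]; apply: sumr_ge0 => q; apply: hook_young_term_ge0.
rewrite (bigD1 1%g) ?level_stab1 //= ltr_wpDr //.
  by apply: sumr_ge0 => q /andP[Cq _]; apply: hook_young_term_ge0; rewrite ?level_stab1.
by rewrite odd_perm1 mul1r mul1g stab_sign1 ltr01.
Qed.

End Hook.

(** The size bounds leave [j = m] and [j = m - 1], and the alternating sum makes these two pairings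
    equal. *)
Lemma young_hook_pairing n j : (0 < d)%N -> (forall x, (cl x < n)%N) -> (m + n = d.+1)%N ->
  (0 < n)%N -> (0 < m)%N ->
  young_pairing j = ((j == m) || (j.+1 == m))%:R * young_pairing m.
Proof.
move=> d_gt0 ltn eq_d n_gt0 m_gt0.
have only i : young_pairing i != 0 -> (i == m) || (i.+1 == m).
  by case/(young_pairing_neq0 ltn)/andP => le_im le_di; lia.
have [->|njm] := eqVneq j m; first by rewrite mul1r.
have [jm|njSm] := eqVneq j.+1 m; last first.
  by apply/eqP; rewrite mul0r; apply: contraTT isT => /only; lia.
rewrite mul1r -jm.
have lt_m : (j.+1 < d.+1)%N by lia.
have lt_j : (j < d.+1)%N by lia.
have := alternating_young_pairing d_gt0.
rewrite (bigD1 (Ordinal lt_j)) //= (bigD1 (Ordinal lt_m)) /=; last first.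
  by rewrite -val_eqE /=; lia.
rewrite big1 => [|i /andP[/eqP nij /eqP nim]].
  rewrite addr0 exprS mulN1r mulrN -mulrBl => /eqP.
  by rewrite mulf_eq0 signr_eq0 orbF subr_eq0 => /eqP.
have [->|/only] := eqVneq (young_pairing i) 0; first by rewrite mul0r.
move=> /orP[/eqP im|/eqP im]; first by case: nim; apply: val_inj; rewrite /= im.
by case: nij; apply: val_inj => /=; lia.
Qed.

End YoungSymmetrizer.

Lemma geq_trans : transitive geq.
Proof. by move=> j i k /= ji kj; apply: leq_trans kj ji. Qed.

Lemma geq_anti : antisymmetric geq.
Proof. by move=> i j /= /andP[ij ji]; lia. Qed.

Lemma geq_total : total geq.
Proof. by move=> i j /=; lia. Qed.

(** * Boxes of the diagram of a partition *)

Section Diagram.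

Variables (d : nat) (la : seq nat).
Hypotheses (d_gt0 : (0 < d)%N) (la_part : is_partition d la).
Implicit Type x : 'I_d.

Lemma partition_sorted : sorted geq la.
Proof. by case/and3P: la_part. Qed.

Lemma mem_partition_gt0 i : i \in la -> (0 < i)%N.
Proof. by case/and3P: la_part => _ la0 _ li; rewrite lt0n; apply: contraNneq la0 => <-. Qed.

Lemma partition_sumn : sumn la = d.
Proof. by case/and3P: la_part => _ _ /eqP. Qed.

Definition box_row x := reshape_index la x.
Definition box_col x := reshape_offset la x.
Definition diagram_box i j : 'I_d := insubd (Ordinal d_gt0) (flatten_index la i j).

Lemma box_row_col_inj x y : box_row x = box_row y -> box_col x = box_col y -> x = y.
Proof.
move=> rxy cxy; apply: val_inj => /=.
by rewrite -(reshape_indexK la x) -/(box_row x) -/(box_col x) rxy cxy reshape_indexK.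
Qed.

Lemma box_col_lt x : (box_col x < nth 0 la (box_row x))%N.
Proof. by apply: reshape_offsetP; rewrite partition_sumn. Qed.

Lemma box_row_lt x : (box_row x < size la)%N.
Proof. by apply: reshape_indexP; rewrite partition_sumn. Qed.

Lemma val_diagram_box i j : (j < nth 0 la i)%N -> diagram_box i j = flatten_index la i j :> nat.
Proof. by move=> lt_j; rewrite val_insubd -{1}partition_sumn flatten_indexP. Qed.

Lemma row_diagram_box i j : (j < nth 0 la i)%N -> box_row (diagram_box i j) = i.
Proof. by move=> lt_j; rewrite /box_row val_diagram_box // flatten_indexKl. Qed.

Lemma col_diagram_box i j : (j < nth 0 la i)%N -> box_col (diagram_box i j) = j.
Proof. by move=> lt_j; rewrite /box_col val_diagram_box // flatten_indexKr. Qed.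

Lemma box_col_lt0 x : (box_col x < nth 0 la 0)%N.
Proof.
apply: leq_trans (box_col_lt x) _.
have geq_refl : reflexive geq by move=> i; apply: leqnn.
have lt0 : (0 < size la)%N by apply: leq_ltn_trans (box_row_lt x).
exact: (sorted_leq_nth geq_trans geq_refl 0%N partition_sorted 0%N (box_row x) lt0 (box_row_lt x) (leq0n _)).
Qed.

End Diagram.

(** * Specht characters and their pairings with exterior powers *)

Section Specht.

Variables (d : nat) (la : seq nat).
Hypotheses (d_gt0 : (0 < d)%N) (la_part : is_partition d la).
Implicit Type I : {set 'I_d}.

Let rw := @box_row d la.
Let cl := @box_col d la.
Let box := diagram_box la d_gt0.
Let box_inj := @box_row_col_inj d la : forall x y, rw x = rw y -> cl x = cl y -> x = y.
Let cl_lt := box_col_lt la_part : forall x, (cl x < nth 0 la (rw x))%N.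
Let rw_lt := box_row_lt la_part : forall x, (rw x < size la)%N.
Let rw_box := row_diagram_box d_gt0 la_part : forall i j, (j < nth 0 la i)%N -> rw (box i j) = i.
Let cl_box := col_diagram_box d_gt0 la_part : forall i j, (j < nth 0 la i)%N -> cl (box i j) = j.
Let cl_lt0 := box_col_lt0 la_part : forall x, (cl x < nth 0 la 0)%N.

Lemma specht_ideal : specht_char d la = ideal_char (young_elt rw cl).
Proof.
suff e : young_symmetrizer d la = gring_elt (young_elt rw cl).
  by rewrite /specht_char /specht_repr e.
rewrite /young_symmetrizer /gring_elt mulmx_suml.
under [RHS]eq_bigr do rewrite scaler_suml.
rewrite [RHS]exchange_big; apply: eq_bigr => p _ /=.
rewrite mulmx_sumr.
under [RHS]eq_bigr do rewrite scaler_suml.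
rewrite [RHS]exchange_big; apply: eq_bigr => q _ /=.
rewrite (bigD1 (p * q)%g) //= eqxx mulr1 big1 ?addr0 => [|g /negbTE].
  by rewrite -scalemxAr -repr_mxM ?inE.
by rewrite eq_sym => ->; rewrite mulr0 scale0r.
Qed.

Lemma specht_irr : specht_char d la \in irr [set: 'S_d]%G.
Proof.
by rewrite specht_ideal; apply: (young_ideal_irr (m := size la) (l := nth 0%N la) (box := box)).
Qed.

Lemma cfdot_specht_ext I :
  young_norm rw cl * '[specht_char d la, ext_char I] = young_pairing rw cl #|I|.
Proof.
rewrite specht_ideal.
exact: (cfdot_young_ext (m := size la) (l := nth 0%N la) (box := box)).
Qed.

Lemma specht_norm_neq0 : young_norm rw cl != 0.
Proof. exact: (young_norm_neq0 (m := size la) (l := nth 0%N la) (box := box)). Qed.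

(** A second row of length at least 2 makes the number of rows plus the first row length at most
    [d]. *)
Lemma specht_nonhook_ext I : (1 < nth 0 la 1)%N -> '[specht_char d la, ext_char I] = 0.
Proof.
move=> la1; apply: (mulfI specht_norm_neq0); rewrite cfdot_specht_ext mulr0.
apply: (young_nonhook_pairing rw_lt _ d_gt0 cl_lt0).
rewrite -[X in (_ <= X)%N](partition_sumn la_part).
case: (la) la1 (mem_partition_gt0 la_part) => [|a [|b r]] //= b_gt1 pos.
suff : (size r <= sumn r)%N by lia.
have {}pos : all (fun i => 0 < i)%N r.
  by apply/allP => i ri; apply: pos; rewrite !inE ri !orbT.
by elim: r pos => //= i r IH /andP[? /IH]; lia.
Qed.

Lemma specht_hook_ext_neq0 I : (forall i, nth 0 la i.+1 <= 1)%N ->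
  (size la + nth 0 la 0 = d.+1)%N ->
  ('[specht_char d la, ext_char I] != 0) = (#|I| == size la) || (#|I|.+1 == size la).
Proof.
move=> la1 la_d; have x0 := Ordinal d_gt0.
have m_gt0 : (0 < size la)%N by apply: leq_ltn_trans (rw_lt x0).
have n_gt0 : (0 < nth 0 la 0)%N by apply: leq_ltn_trans (cl_lt0 x0).
have rwcl x : rw x = 0%N \/ cl x = 0%N.
  by have := cl_lt x; case: (rw x) => [|i]; [left|have := la1 i; lia].
have pos : 0 < young_pairing rw cl (size la).
  apply: (hook_young_pairing_gt0 (l := nth 0%N la) (box := box)) => // i lt_i.
  by apply: (mem_partition_gt0 la_part); apply: mem_nth.
have n0 := specht_norm_neq0; rewrite -[LHS](_ : (young_pairing rw cl #|I| != 0) = _).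
  rewrite (young_hook_pairing rw_lt _ d_gt0 cl_lt0) //.
  by case: (_ || _); rewrite ?mul1r ?mul0r ?eqxx ?gt_eqF.
by rewrite -cfdot_specht_ext mulf_eq0 (negbTE n0).
Qed.

End Specht.

Definition hook (d k : nat) : seq nat := (d - k)%N :: nseq k 1%N.

Lemma hook_is_partition d k : (k < d)%N -> is_partition d (hook d k).
Proof.
move=> lt_kd; rewrite /is_partition /hook; apply/and3P; split.
- by case: k lt_kd => [|k] //= lt_kd; rewrite subn_gt0 lt_kd; elim: k {lt_kd}.
- by rewrite inE mem_nseq negb_or andbF andbT; lia.
- by rewrite /= sumn_nseq; lia.
Qed.

Lemma specht_hook_ext d k (I : {set 'I_d}) : (k < d)%N ->
  ('[specht_char d (hook d k), ext_char I] != 0) = (#|I| == k) || (#|I| == k.+1).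
Proof.
move=> lt_kd; have d_gt0 : (0 < d)%N by lia.
rewrite specht_hook_ext_neq0 ?hook_is_partition //=.
- by rewrite size_nseq eqSS orbC.
- by move=> i; rewrite nth_nseq; case: ifP.
- by rewrite size_nseq; lia.
Qed.

(** * Characters of hooks *)

Section SmallNorm.

Variables (gT : finGroupType) (G : {group gT}).
Implicit Types phi chi : 'CF(G).

Lemma cfdot_irr_char_ge1 chi phi : chi \in irr G -> phi \is a character ->
  '[chi, phi] != 0 -> 1 <= '[chi, phi].
Proof.
move=> /irrP[i ->] Nphi nz.
have /natrP[n E] : '['chi_i, phi] \in Num.nat by rewrite Cnat_cfdot_char ?irr_char.
by move: nz; rewrite E pnatr_eq0 ler1n lt0n.
Qed.

Lemma cfdot_real_char chi phi : chi \is a character -> phi \is a character ->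
  '[phi, chi] = '[chi, phi].
Proof.
move=> Nchi Nphi; rewrite cfdotC; apply/CrealP/Rreal_nat.
by rewrite Cnat_cfdot_char.
Qed.

(** The norm of [phi - chi] is at most 1 + 1 - 2. *)
Lemma char_eq_irr chi phi : chi \in irr G -> phi \is a character ->
  '[phi] <= 1 -> '[chi, phi] != 0 -> phi = chi.
Proof.
move=> Ichi Nphi le1 nz; have ge1 := cfdot_irr_char_ge1 Ichi Nphi nz.
have Nchi := irrWchar Ichi.
have n1 : '[chi] = 1 by apply/eqP; move: Ichi; rewrite irrEchar => /andP[].
apply/eqP; rewrite -subr_eq0 -cfnorm_eq0 eq_le cfnorm_ge0 andbT.
rewrite cfnormB n1 -cfdotC (cfdot_real_char Nchi Nphi) subr_le0 lerD //.
exact: le_trans le1 ge1.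
Qed.

(** Distinct irreducibles are orthogonal, so the norm of [phi - (chi1 + chi2)] is at most 2 + 2 -
    4. *)
Lemma char_eq_sum_irr chi1 chi2 phi : chi1 \in irr G -> chi2 \in irr G ->
  phi \is a character -> chi1 != chi2 -> '[phi] <= 2%:R ->
  '[chi1, phi] != 0 -> '[chi2, phi] != 0 -> phi = chi1 + chi2.
Proof.
move=> I1 I2 Nphi n12 le2 nz1 nz2.
have ge1 := cfdot_irr_char_ge1 I1 Nphi nz1; have ge2 := cfdot_irr_char_ge1 I2 Nphi nz2.
have N1 := irrWchar I1; have N2 := irrWchar I2.
have n1 : '[chi1] = 1 by apply/eqP; move: I1; rewrite irrEchar => /andP[].
have n2 : '[chi2] = 1 by apply/eqP; move: I2; rewrite irrEchar => /andP[].
have o12 : '[chi1, chi2] = 0.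
  case/irrP: I1 n12 => i ->; case/irrP: I2 => j ->; rewrite cfdot_irr => nij.
  by case: (eqVneq i j) nij => [->|//]; rewrite eqxx.
have ge12 : 2%:R <= '[chi1 + chi2, phi] by rewrite cfdotDl lerD.
apply/eqP; rewrite -subr_eq0 -cfnorm_eq0 eq_le cfnorm_ge0 andbT.
rewrite cfnormB (cfnormDd o12) n1 n2 -cfdotC (cfdot_real_char (rpredD N1 N2) Nphi) subr_le0 lerD //.
exact: le_trans le2 ge12.
Qed.

End SmallNorm.

(* [e] and [a] stand for the exterior power and hook characters *)
Lemma telescoping_pieri (a e : nat -> algC) (Y : {poly algC}) n : e 0%N = a 0%N ->
  (forall j, (j < n)%N -> e j.+1 = a j.+1 + a j) ->
  \sum_(j < n.+1) e j *: Y ^+ j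
    = (1 + Y) * (\sum_(k < n.+1) a k *: Y ^+ k) - a n *: Y ^+ n.+1.
Proof.
move=> e0; elim: n => [|n IHn] eS.
  by rewrite !big_ord1 e0 expr0 expr1 mulrDl mul1r -scalerAr mulr1 addrK.
rewrite big_ord_recr IHn => [|j lt_jn]; last by apply: eS; apply: ltnW.
rewrite [in RHS]big_ord_recr /= eS // -!mul_polyC polyCD !exprS; ring.
Qed.

Section HookCharacters.

Variable d : nat.
Hypothesis d_gt0 : (0 < d)%N.
Implicit Types (I : {set 'I_d}) (s : 'S_d).

Local Notation chi k := (specht_char d (hook d k)).

Definition initial_set j : {set 'I_d} := [set x : 'I_d | x < j]%N.

Lemma card_initial_set j : (j <= d)%N -> #|initial_set j| = j.
Proof.
move=> le_jd; have inj : injective (widen_ord le_jd) by move=> x y [] /val_inj.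
rewrite -[RHS]card_ord -[RHS](card_imset _ inj).
apply: eq_card => x; rewrite inE; apply/idP/imsetP => [lt_xj|[y _ ->]]; last exact: (ltn_ord y).
by exists (Ordinal lt_xj) => //; apply: val_inj.
Qed.

Lemma hook_irr k : (k < d)%N -> chi k \in irr [set: 'S_d]%G.
Proof. by move=> lt_kd; apply: specht_irr => //; apply: hook_is_partition. Qed.

Lemma hook_char_inj j k : (j < d)%N -> (k < d)%N -> chi j = chi k -> j = k.
Proof.
wlog lt_jk : j k / (j < k)%N => [IH lt_jd lt_kd e|lt_jd lt_kd e].
  by case: (ltngtP j k) => // /IH -> //; rewrite e.
have cj : #|initial_set j| = j by rewrite card_initial_set // ltnW.
have := specht_hook_ext (initial_set j) lt_jd; rewrite e specht_hook_ext // cj; lia.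
Qed.

Lemma ext_char0 : ext_char (set0 : {set 'I_d}) = chi 0.
Proof.
have ext1 : ext_char (set0 : {set 'I_d}) = 1.
  apply/cfunP => s; rewrite ext_charE cfun1E inE cards0 (bigD1 set0) ?cards0 //= big1.
    rewrite addr0 /stab_sign; case: ifP => [Ns|/negP[]]; last by apply/stabP => x; rewrite !inE.
    rewrite (restr_perm_eq (t := 1%g)) ?odd_perm1 // => x; rewrite ?inE // perm1 //.
  by move=> J /andP[]; rewrite cards_eq0 => ->.
apply: (char_eq_irr (hook_irr d_gt0) (ext_char_char _)).
  by rewrite ext1 cfnorm1.
by rewrite specht_hook_ext // cards0.
Qed.

Lemma ext_charS I j : (j.+1 < d)%N -> #|I| = j.+1 -> ext_char I = chi j.+1 + chi j.
Proof.
move=> lt_jd cI.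
apply: (char_eq_sum_irr (hook_irr lt_jd) (hook_irr (ltnW lt_jd)) (ext_char_char _)).
- by apply/eqP => /hook_char_inj e; have := e lt_jd (ltnW lt_jd); lia.
- exact: cfnorm_ext_char.
- by rewrite specht_hook_ext // cI eqxx.
- by rewrite specht_hook_ext ?(ltnW lt_jd) // cI eqxx orbT.
Qed.

Lemma hook_char_poly s :
  (1 - 'X) * \sum_(k < d) chi k s *: (- 'X) ^+ k
     = \prod_(c in porbits s) (1 - 'X^#|c|) :> {poly algC}.
Proof.
have := porbit_poly_root1 s (Ordinal d_gt0); rewrite -sum_stab_sign.
have lt (J : {set 'I_d}) : (#|J| < d.+1)%N by rewrite ltnS -[X in (_ <= X)%N]card_ord max_card.
rewrite (partition_big (fun J : {set 'I_d} => Ordinal (lt J)) predT) //=.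
rewrite (eq_bigr (fun j : 'I_d.+1 => ext_char (initial_set j) s *: (- 'X) ^+ j)); last first.
  move=> j _; rewrite ext_charE card_initial_set -1?ltnS // scaler_suml.
  by apply: eq_bigr => J /eqP <-.
set P := \sum_(j < d.+1) _; set S := \sum_(k < d) _ => P1.
(* The two-hook decomposition covers sizes below [d]; the top size leaves an unknown multiple of
   [(- 'X) ^+ d], which evaluation at 1 shows to be zero. *)
have [a E] : exists a : algC, P = (1 - 'X) * S + a *: (- 'X) ^+ d.
  exists (ext_char (initial_set d) s - chi d.-1 s).
  rewrite /P /S big_ord_recr /= scalerBl [RHS]addrCA addrC; congr (_ + _).
  have := @telescoping_pieri (fun k => chi k s) (fun j => ext_char (initial_set j) s) (- 'X) d.-1.
  rewrite !prednK //; apply=> [|j lt_j].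
    by rewrite -ext_char0 (_ : initial_set 0 = set0) //; apply/setP => x; rewrite !inE.
  by rewrite (@ext_charS _ j) ?cfunE ?card_initial_set //; lia.
move: P1; rewrite E hornerD hornerM !hornerE subrr mul0r add0r => /eqP.
rewrite mulf_eq0 expf_eq0 oppr_eq0 oner_eq0 andbF orbF => /eqP->.
by rewrite scale0r addr0.
Qed.

End HookCharacters.

Lemma prod_cycle_type (R : comPzRingType) d (s : 'S_d) (f : nat -> R) :
  \prod_(c in porbits s) f #|c| = \prod_(b <- cycle_type s) f b.
Proof.
rewrite (perm_big _ (permEl (perm_sort geq _))) big_map /=.
by rewrite big_enum.
Qed.

(** * Character values on a long cycle *)

Section LongCycle.

Variables (d : nat) (s : 'S_d).
Hypotheses (d_gt0 : (0 < d)%N) (s_cycle : cycle_type s = [:: d]).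

Local Notation chi k := (specht_char d (hook d k)).

(** The cycle product is [1 - 'X^d]; cancelling [1 - 'X] leaves a geometric sum, whose coefficients
    are compared. *)
Lemma hook_char_cycle k : (k < d)%N -> chi k s = (-1) ^+ k.
Proof.
move=> lt_kd; have := hook_char_poly d_gt0 s.
rewrite (prod_cycle_type s (fun n => 1 - 'X^n)) s_cycle big_seq1.
rewrite -[1 - 'X^d]opprB subrX1 -mulNr opprB => /(mulfI _) E.
have {E} : \sum_(i < d) chi i s *: (- 'X) ^+ i = \sum_(i < d) 'X^i :> {poly algC}.
  by apply: E; rewrite -opprB oppr_eq0 polyXsubC_eq0.
move/(congr1 (fun p : {poly algC} => p`_k)).
have coef_sum (a : nat -> algC) : (\sum_(i < d) a i *: 'X^i : {poly algC})`_k = a k.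
  by rewrite -poly_def coef_poly lt_kd.
rewrite (eq_bigr (fun i : 'I_d => (chi i s * (-1) ^+ i) *: 'X^i)); last first.
  by move=> i _; rewrite -scalerA -[X in _ = _ *: X]mul_polyC rmorph_sign -exprNn.
rewrite (coef_sum (fun i => chi i s * (-1) ^+ i)).
have -> : \sum_(i < d) 'X^i = \sum_(i < d) 1 *: 'X^i :> {poly algC}.
  by apply: eq_bigr => i _; rewrite scale1r.
rewrite (coef_sum (fun=> 1)) => /(congr1 (fun x => x * (-1) ^+ k)).
by rewrite -mulrA -expr2 sqrr_sign mulr1 mul1r.
Qed.

Lemma long_cycle_porbit : exists x, porbit s x = setT.
Proof.
have : d \in cycle_type s by rewrite s_cycle inE.
rewrite mem_sort => /mapP[c]; rewrite mem_enum => /imsetP[x _ ->] dE; exists x.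
by apply/eqP; rewrite eqEcard subsetT cardsT card_ord -dE leqnn.
Qed.

(** The powers of [s] act transitively, so an element commuting with [s] is determined by the image
    of one point. *)
Lemma card_cent_long_cycle : (#|'C[s]%g| <= d)%N.
Proof.
have [x sx] := long_cycle_porbit.
rewrite -[X in (_ <= X)%N]card_ord -(card_in_imset (f := fun t : 'S_d => t x)) ?max_card //.
move=> t u /cent1P ts /cent1P us tux; apply/permP => y.
have /porbitP[i ->] : y \in porbit s x by rewrite sx.
by rewrite -!permM -(commuteX i ts) -(commuteX i us) !permM tux.
Qed.

(** The hook values already contribute [d] to the sum of squared absolute values, which is the order
    of the centraliser and thus at most [d]. *)
Lemma specht_nonhook_cycle la : is_partition d la -> (1 < nth 0 la 1)%N ->
  specht_char d la s = 0.
Proof.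
move=> la_part la1.
pose hk (k : 'I_d) := cfIirr (chi k).
have hkE k : 'chi_(hk k) = chi k by rewrite cfIirrE ?hook_irr.
have hk_inj : injective hk.
  move=> j k /(congr1 (fun i => 'chi_i)); rewrite !hkE => /hook_char_inj e.
  by apply: val_inj; apply: e.
have /irrP[i0 i0E] := specht_irr d_gt0 la_part.
(* A hook pairs nontrivially with the exterior power of degree [k], a shape that is no hook pairs to
   0. *)
have i0hk : i0 \notin hk @: setT.
  apply/imsetP => -[k _ i0k].
  have := specht_hook_ext (initial_set d k) (ltn_ord k).
  rewrite card_initial_set ?(ltnW (ltn_ord k)) // eqxx -hkE -i0k -i0E.
  by rewrite specht_nonhook_ext // eqxx.
have := second_orthogonality_relation s (in_setT s : s \in [set: 'S_d]%G).
rewrite class_refl mulr1n setTI => so.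
have : \sum_i `|'chi[[set: 'S_d]%G]_i s| ^+ 2 <= d%:R.
  rewrite (eq_bigr _ (fun i _ => normCK _)) so ler_nat; exact: card_cent_long_cycle.
rewrite (bigID (mem (hk @: setT))) /= big_imset /=; last by move=> ? ? _ _; apply: hk_inj.
rewrite (eq_bigr (fun=> 1)); last first.
  by move=> k _; rewrite hkE hook_char_cycle // normr_sign expr1n.
rewrite sumr_const cardsT card_ord gerDl => le0.
have : \sum_(i | i \notin hk @: setT) `|'chi[[set: 'S_d]%G]_i s| ^+ 2 = 0.
  by apply: le_anti; rewrite le0 sumr_ge0 // => i _; rewrite exprn_ge0.
move/psumr_eq0P => /(_ (fun i _ => exprn_ge0 _ (normr_ge0 _)) i0 i0hk)/eqP.
by rewrite expf_eq0 normr_eq0 i0E => /eqP.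
Qed.

End LongCycle.

(** * Permutations of given cycle type *)

Section PermOfType.

Variables (d : nat) (be : seq nat).
Hypotheses (d_gt0 : (0 < d)%N) (be_part : is_partition d be).

Let rw := @box_row d be.
Let cl := @box_col d be.
Let box := diagram_box be d_gt0.
Let block_inj := @box_row_col_inj d be : forall x y, rw x = rw y -> cl x = cl y -> x = y.
Let cl_lt := box_col_lt be_part : forall x, (cl x < nth 0 be (rw x))%N.
Let rw_lt := box_row_lt be_part : forall x, (rw x < size be)%N.
Let rw_box := row_diagram_box d_gt0 be_part : forall i j, (j < nth 0 be i)%N -> rw (box i j) = i.
Let cl_box := col_diagram_box d_gt0 be_part : forall i j, (j < nth 0 be i)%N -> cl (box i j) = j.

(** Rotating each row of the diagram of [be] cyclically makes the rows the cycles of a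
    permutation. *)
Let shift_cl x := if ((cl x).+1 < nth 0 be (rw x))%N then (cl x).+1 else 0%N.
Let shift x := box (rw x) (shift_cl x).

Let shift_lt x : (shift_cl x < nth 0 be (rw x))%N.
Proof. by rewrite /shift_cl; case: ifP => // _; apply: leq_ltn_trans (cl_lt x). Qed.

Let shift_inj : injective shift.
Proof.
move=> x y e; have rxy : rw x = rw y by rewrite -(rw_box (shift_lt x)) -(rw_box (shift_lt y)) -/(shift x) e.
apply: block_inj => //; have := congr1 cl e; rewrite !cl_box //.
by have := cl_lt x; have := cl_lt y; rewrite /shift_cl rxy; do 2!case: ifP; lia.
Qed.

Let s := perm shift_inj.

Let porbit_block x : porbit s x = [set y | rw y == rw x].
Proof.
have rwX i y : rw ((s ^+ i)%g y) = rw y.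
  elim: i => [|i IHi]; first by rewrite expg0 perm1.
  by rewrite expgSr permM permE rw_box.
have start i j : (j < nth 0 be i)%N -> box i j \in porbit s (box i 0).
  elim: j => [|j IHj] lt_j; first exact: porbit_id.
  have lt_j' := ltnW lt_j; have /porbitP[k zE] := IHj lt_j'.
  apply/porbitP; exists k.+1; rewrite expgSr permM -zE permE.
  by rewrite /shift /shift_cl rw_box // cl_box // lt_j.
have boxE y : y = box (rw y) (cl y) by apply: block_inj; rewrite ?rw_box ?cl_box.
apply/setP => y; rewrite inE; apply/idP/eqP => [/porbitP[i ->] //|rxy].
have start' z : porbit s z = porbit s (box (rw z) 0).
  by apply/eqP; rewrite eq_porbit_mem {1}[z]boxE start.
by rewrite -eq_porbit_mem start' rxy -start'.
Qed.

Let card_block i : (i < size be)%N -> #|[set x | rw x == i]| = nth 0%N be i.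
Proof.
move=> lt_i; rewrite -[RHS]card_ord.
have inj : injective (fun j : 'I_(nth 0%N be i) => box i j).
  by move=> j k /(congr1 cl); rewrite !cl_box // => /val_inj.
rewrite -[RHS](card_imset _ inj); apply: eq_card => x; rewrite inE.
apply/eqP/imsetP => [rx|[j _ ->]]; last by rewrite rw_box.
have lt_x := cl_lt x; rewrite rx in lt_x; exists (Ordinal lt_x) => //=.
by apply: block_inj; rewrite ?rw_box ?cl_box.
Qed.

Let block_gt0 i : (i < size be)%N -> (0 < nth 0 be i)%N.
Proof. by move=> lt_i; apply: (mem_partition_gt0 be_part); apply: mem_nth. Qed.

Lemma cycle_type_exists : exists t : 'S_d, cycle_type t == be.
Proof.
exists s; apply/eqP.
apply: (sorted_eq geq_trans geq_anti (sort_sorted geq_total _) (partition_sorted be_part)).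
rewrite perm_sort; pose L (i : 'I_(size be)) := [set x | rw x == i].
have L_inj : injective L.
  move=> i j /setP/(_ (box i 0)); rewrite !inE rw_box ?block_gt0 // eqxx => /esym/eqP.
  by move/val_inj.
have pE : perm_eq (enum (porbits s)) (map L (enum 'I_(size be))).
  apply: uniq_perm => [||c]; [exact: enum_uniq|by rewrite map_inj_uniq ?enum_uniq|].
  rewrite mem_enum; apply/imsetP/mapP => [[x _ ->]|[i _ ->]].
    by exists (Ordinal (rw_lt x)); rewrite ?mem_enum ?porbit_block.
  by exists (box i 0); rewrite // porbit_block rw_box ?block_gt0.
rewrite (perm_trans (perm_map _ pE)) // -map_comp.
rewrite (_ : map _ _ = map (nth 0%N be) (map val (enum 'I_(size be)))).
  by rewrite val_enum_ord map_nth_iota0 ?take_size.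
by rewrite -map_comp; apply: eq_map => i /=; rewrite /L card_block.
Qed.

Lemma perm_of_typeP : cycle_type (perm_of_type d be) = be.
Proof.
rewrite /perm_of_type; case: pickP => [t /eqP //|none].
by have [t] := cycle_type_exists; rewrite none.
Qed.

End PermOfType.

(** * The ring of formal power series *)

Section FpsRing.

Variable F : fieldType.
Implicit Types (a b c : fps F) (n N : nat).

Definition fps_add a b : fps F := fun n => a n + b n.
Definition fps_opp a : fps F := fun n => - a n.
Definition fps0 : fps F := fun=> 0.

Lemma fpsP a b : (forall n, a n = b n) -> a = b.
Proof. exact: funext. Qed.

Lemma fps_addA : associative fps_add.
Proof. by move=> a b c; apply: fpsP => n; rewrite /fps_add addrA. Qed.
Lemma fps_addC : commutative fps_add.
Proof. by move=> a b; apply: fpsP => n; rewrite /fps_add addrC. Qed.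
Lemma fps_add0 : left_id fps0 fps_add.
Proof. by move=> a; apply: fpsP => n; rewrite /fps_add add0r. Qed.
Lemma fps_addN : left_inverse fps0 fps_opp fps_add.
Proof. by move=> a; apply: fpsP => n; rewrite /fps_add /fps_opp addNr. Qed.

(** Truncation to polynomials, from which commutativity and associativity are inherited. *)
Lemma fps_mulE a b n N : (n < N)%N ->
  fps_mul a b n = (\poly_(i < N) a i * \poly_(i < N) b i)`_n.
Proof.
move=> lt_nN; rewrite coefM; apply: eq_bigr => i _; rewrite !coef_poly.
by rewrite !(leq_ltn_trans _ lt_nN) ?leq_subr // -ltnS.
Qed.

Lemma coefM_eq (p p' q q' : {poly F}) n : (forall i, (i <= n)%N -> p`_i = p'`_i) ->
  (forall i, (i <= n)%N -> q`_i = q'`_i) -> (p * q)`_n = (p' * q')`_n.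
Proof.
move=> pp qq; rewrite !coefM; apply: eq_bigr => i _.
by rewrite pp ?qq ?leq_subr // -ltnS.
Qed.

Lemma fps_mulC : commutative (@fps_mul F).
Proof. by move=> a b; apply: fpsP => n; rewrite !(fps_mulE _ _ (ltnSn n)) mulrC. Qed.

Lemma fps_mulA : associative (@fps_mul F).
Proof.
move=> a b c; apply: fpsP => n; rewrite !(fps_mulE _ _ (ltnSn n)).
pose P (a : fps F) := \poly_(i < n.+1) a i.
transitivity (P a * (P b * P c))`_n.
  apply: coefM_eq => // i le_in; rewrite coef_poly ltnS le_in.
  by rewrite (@fps_mulE _ _ i n.+1).
rewrite mulrA; apply: coefM_eq => // i le_in; rewrite coef_poly ltnS le_in.
by rewrite (@fps_mulE _ _ i n.+1).
Qed.

Lemma fps_mul1 : left_id (@fps1 F) (@fps_mul F).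
Proof.
move=> a; apply: fpsP => n; rewrite /fps_mul big_ord_recl big1 => [|i _].
  by rewrite addr0 subn0 mul1r.
by rewrite mul0r.
Qed.

Lemma fps_mulD : left_distributive (@fps_mul F) fps_add.
Proof.
move=> a b c; apply: fpsP => n; rewrite /fps_mul /fps_add -big_split /=.
by apply: eq_bigr => i _; rewrite mulrDl.
Qed.

Lemma fps1_neq0 : @fps1 F <> fps0.
Proof. by move/(congr1 (fun a : fps F => a 0%N))/eqP; rewrite oner_eq0. Qed.

End FpsRing.

HB.instance Definition _ (F : fieldType) := gen_eqMixin (fps F).
HB.instance Definition _ (F : fieldType) := gen_choiceMixin (fps F).
HB.instance Definition _ (F : fieldType) :=
  GRing.isZmodule.Build (fps F) (@fps_addA F) (@fps_addC F) (@fps_add0 F) (@fps_addN F).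

Fact fps1_eqF (F : fieldType) : (@fps1 F : fps F) != 0.
Proof. by apply/eqP; apply: fps1_neq0. Qed.

HB.instance Definition _ (F : fieldType) :=
  GRing.Zmodule_isComNzRing.Build (fps F) (@fps_mulA F) (@fps_mulC F) (@fps_mul1 F)
    (@fps_mulD F) (fps1_eqF F).

Definition fpsC (F : fieldType) (c : F) : fps F := fun n => c *+ (n == 0%N).
Definition fpsX (F : fieldType) : fps F := fun n => (n == 1%N)%:R.
Definition fps_deriv (F : fieldType) (a : fps F) : fps F := fun n => a n.+1 *+ n.+1.

Lemma geometric_sum (R : comPzRingType) (u : R) n :
  (1 - u) * \sum_(k < n) u ^+ k = 1 - u ^+ n.
Proof. by rewrite -[RHS]opprB subrX1 -mulNr opprB. Qed.

Section FpsTheory.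

Variable F : fieldType.
Implicit Types (a b l m : fps F) (c e : F) (n N : nat).

Lemma fpsDE a b n : (a + b) n = a n + b n. Proof. by []. Qed.
Lemma fpsNE a n : (- a) n = - a n. Proof. by []. Qed.
Lemma fpsBE a b n : (a - b) n = a n - b n. Proof. by []. Qed.
Lemma fpsME a b n : (a * b) n = \sum_(i < n.+1) a i * b (n - i)%N. Proof. by []. Qed.

Lemma fps_sumE (I : Type) (r : seq I) (P : pred I) (f : I -> fps F) n :
  (\sum_(i <- r | P i) f i) n = \sum_(i <- r | P i) f i n.
Proof. by elim/big_rec2: _ => // i x y _ <-. Qed.

Lemma fps_expE a k : fps_exp a k = a ^+ k.
Proof. by elim: k => // k IHk; rewrite exprS -IHk. Qed.

Lemma fpsME0 a b : (a * b) 0%N = a 0%N * b 0%N.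
Proof. by rewrite fpsME big_ord1. Qed.

Lemma fpsCM c a n : (fpsC c * a) n = c * a n.
Proof.
rewrite fpsME big_ord_recl big1 ?addr0 ?subn0 // => i _.
by rewrite /fpsC /= mul0r.
Qed.

Lemma fpsXM a n : (fpsX F * a) n.+1 = a n.
Proof.
rewrite fpsME big_ord_recl mul0r add0r big_ord_recl big1 ?addr0 => [|i _].
  by rewrite /fpsX mul1r subSS subn0.
by rewrite mul0r.
Qed.

Lemma fpsXM0 a : (fpsX F * a) 0%N = 0.
Proof. by rewrite fpsME0 mul0r. Qed.

Lemma fpsX_inj a b : fpsX F * a = fpsX F * b -> a = b.
Proof. by move=> e; apply: fpsP => n; rewrite -fpsXM e fpsXM. Qed.

Lemma fpsXnM k a n : (fpsX F ^+ k * a) (n + k)%N = a n.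
Proof. by elim: k => [|k IHk]; rewrite ?expr0 ?mul1r ?addn0 // addnS exprS -mulrA fpsXM. Qed.

Lemma fpsXnM_lt k a n : (n < k)%N -> (fpsX F ^+ k * a) n = 0.
Proof.
elim: k n => // k IHk [|n] lt; rewrite exprS -mulrA ?fpsXM0 // fpsXM IHk //.
Qed.

Fact fpsC_zmod : zmod_morphism (@fpsC F).
Proof. by move=> c e; apply: fpsP => n; rewrite fpsBE /fpsC mulrnBl. Qed.

Fact fpsC_monoid : monoid_morphism (@fpsC F).
Proof. by split=> [|c e]; apply: fpsP => n //; rewrite fpsCM /fpsC -mulrnAr. Qed.

HB.instance Definition _ := GRing.isZmodMorphism.Build F (fps F) (@fpsC F) fpsC_zmod.
HB.instance Definition _ := GRing.isMonoidMorphism.Build F (fps F) (@fpsC F) fpsC_monoid.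

Lemma fps_mul_eq_upto a a' b b' n : (forall i, (i <= n)%N -> a i = a' i) ->
  (forall i, (i <= n)%N -> b i = b' i) -> (a * b) n = (a' * b') n.
Proof.
move=> aa bb; rewrite !fpsME; apply: eq_bigr => i _.
by rewrite aa ?bb ?leq_subr // -ltnS.
Qed.

Lemma fps_expr_lt a k n : a 0%N = 0 -> (n < k)%N -> (a ^+ k) n = 0.
Proof.
move=> a0; elim: k n => // k IHk n lt; rewrite exprS fpsME big1 // => -[[|i] lt_i] _ /=.
  by rewrite a0 mul0r.
by rewrite IHk ?mulr0 //; lia.
Qed.

(** A single cutoff [N] serves all coefficients below it, since [a ^+ k] starts in degree [k] or
    later. *)
Lemma fps_compE f a n N : a 0%N = 0 -> (n < N)%N ->
  fps_comp f a n = (\sum_(k < N) fpsC (f k) * a ^+ k) n.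
Proof.
move=> a0 lt_nN; rewrite /fps_comp fps_sumE.
under eq_bigr do rewrite fps_expE.
rewrite (big_ord_widen N (fun k => f k * (a ^+ k) n)) // big_mkcond /=.
apply: eq_bigr => k _; rewrite fpsCM; case: ifP => // /negbT; rewrite -leqNgt => lt.
by rewrite fps_expr_lt ?mulr0.
Qed.

(** Geometric series in [1 - a]; the remainder [(1 - a) ^+ n.+1] has no term of degree [n]. *)
Lemma fps_mulVr a : a 0%N = 1 -> a * fps_inv a = 1.
Proof.
move=> a0; apply: fpsP => n; have u0 : (1 - a) 0%N = 0 by rewrite fpsBE a0 subrr.
have invE i : (i <= n)%N -> fps_inv a i = (\sum_(k < n.+1) (1 - a) ^+ k) i.
  move=> le_in; rewrite /fps_inv (@fps_compE _ _ i n.+1) // !fps_sumE.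
  by apply: eq_bigr => k _; rewrite rmorph1 mul1r.
rewrite (fps_mul_eq_upto (a' := 1 - (1 - a)) _ invE); last by rewrite opprB addrCA subrr addr0.
by rewrite geometric_sum fpsBE fps_expr_lt // subr0.
Qed.

Lemma fps_derivD a b : fps_deriv (a + b) = fps_deriv a + fps_deriv b.
Proof. by apply: fpsP => n; rewrite /fps_deriv !fpsDE mulrnDl. Qed.

Lemma fps_deriv0 : fps_deriv (0 : fps F) = 0.
Proof. by apply: fpsP => n; rewrite /fps_deriv mul0rn. Qed.

Lemma fps_deriv_sum (I : Type) (r : seq I) (P : pred I) (f : I -> fps F) :
  fps_deriv (\sum_(i <- r | P i) f i) = \sum_(i <- r | P i) fps_deriv (f i).
Proof. by apply: (big_morph (@fps_deriv F) fps_derivD fps_deriv0). Qed.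

Lemma fps_derivC c : fps_deriv (fpsC c) = 0 :> fps F.
Proof. by apply: fpsP => n; rewrite /fps_deriv /fpsC mul0rn. Qed.

Lemma fps_derivM a b : fps_deriv (a * b) = fps_deriv a * b + a * fps_deriv b.
Proof.
apply: fpsP => n; pose P a := \poly_(i < n.+2) a i : {poly F}.
have PM (x y : fps F) i : (i < n.+2)%N -> (x * y) i = (P x * P y)`_i.
  by move=> lt; apply: fps_mulE.
have dP (x : fps F) i : (i <= n)%N -> (P (fps_deriv x))`_i = ((P x)^`())`_i.
  by move=> le_in; rewrite coef_deriv !coef_poly !ltnS le_in leqW.
rewrite /fps_deriv fpsDE PM // -coef_deriv derivM coefD.
by rewrite !PM //; congr (_ + _); apply: coefM_eq => // i le_in; rewrite dP.
Qed.

Lemma fps_derivX a k : fps_deriv (a ^+ k.+1) = (a ^+ k * fps_deriv a) *+ k.+1.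
Proof.
elim: k => [|k IHk]; first by rewrite expr1 expr0 mul1r.
by rewrite exprS fps_derivM IHk mulrnAr mulrA -exprS mulrC -mulrS.
Qed.

Hypothesis charF : forall n, n.+1%:R != 0 :> F.

(** The derivative of the truncated logarithm is a geometric sum in [1 - a] times the derivative of
    [a]; multiplying by [a] leaves a remainder of degree above [n]. *)
Lemma fps_log_deriv a : a 0%N = 1 -> fps_deriv a = a * fps_deriv (fps_log a).
Proof.
move=> a0; apply: fpsP => n; have u0 : (a - 1) 0%N = 0 by rewrite fpsBE a0 subrr.
pose f k : F := if k is k'.+1 then (-1) ^+ k' / k%:R else 0.
pose L := \sum_(k < n.+2) fpsC (f k) * (a - 1) ^+ k.
have LE i : (i <= n)%N -> fps_deriv (fps_log a) i = fps_deriv L i.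
  by move=> le_in; rewrite /fps_deriv /fps_log (@fps_compE _ _ i.+1 n.+2).
rewrite (fps_mul_eq_upto (a' := a) _ LE) //.
have -> : fps_deriv L = (\sum_(k < n.+1) (1 - a) ^+ k) * fps_deriv a.
  rewrite /L big_ord_recl rmorph0 mul0r add0r fps_deriv_sum mulr_suml.
  apply: eq_bigr => k _; rewrite fps_derivM fps_derivC mul0r add0r fps_derivX.
  have -> : fps_deriv (a - 1) = fps_deriv a.
    by rewrite fps_derivD -(rmorphN1 (@fpsC F)) fps_derivC addr0.
  have fk : f k.+1 *+ k.+1 = (-1) ^+ k by rewrite /f -[_ *+ _]mulr_natr divfK.
  rewrite -mulrnAl mulrA; congr (_ * _); rewrite mulrnAr -mulrnAl -(rmorphMn (@fpsC F)).
  by rewrite [f _ *+ _]fk rmorph_sign -exprMn mulN1r opprB.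
rewrite mulrA (_ : a * _ = 1 - (1 - a) ^+ n.+1); last first.
  by rewrite -geometric_sum; congr (_ * _); rewrite opprB addrCA subrr addr0.
rewrite mulrBl mul1r fpsBE fpsME big1 ?subr0 // => i _.
by rewrite fps_expr_lt ?mul0r // fpsBE a0 subrr.
Qed.

End FpsTheory.

(** * Logarithmic derivatives, scaling and parity *)

Section LogDerivative.

Variable F : fieldType.
Implicit Types (a b l m : fps F) (c e : F) (n N : nat).

(* [a = exp l] up to a constant factor *)
Definition logder a l := fps_deriv a = a * fps_deriv l.

Lemma logder1 : logder 1 0.
Proof. by rewrite /logder fps_deriv0 mulr0 -(rmorph1 (@fpsC F)) fps_derivC. Qed.

Lemma logderM a b l m : logder a l -> logder b m -> logder (a * b) (l + m).
Proof.
rewrite /logder fps_derivM fps_derivD => -> ->; ring.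
Qed.

Lemma logderV a b l : a * b = 1 -> logder a l -> logder b (- l).
Proof.
move=> ab al; have Db : fps_deriv a * b + a * fps_deriv b = 0.
  by rewrite -fps_derivM ab -(rmorph1 (@fpsC F)) fps_derivC.
have DN : fps_deriv (- l) = - fps_deriv l.
  by apply: fpsP => n; rewrite fpsNE /fps_deriv fpsNE mulNrn.
rewrite /logder DN -[LHS]mul1r -ab mulrAC mulrC.
have -> : a * fps_deriv b = - (fps_deriv a * b) by apply/eqP; rewrite -addr_eq0 addrC Db.
by rewrite al mulrAC ab mul1r.
Qed.

Lemma logderX a l k : logder a l -> logder (a ^+ k) (l *+ k).
Proof.
move=> al; elim: k => [|k IHk]; first exact: logder1.
by rewrite exprS mulrS; apply: logderM.
Qed.

Lemma logder_expz a l (c : int) : a 0%N = 1 -> logder a l -> logder (fps_expz a c) (l *~ c).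
Proof.
move=> a0 al; case: c => k; rewrite /fps_expz fps_expE; first exact: logderX.
rewrite NegzE mulrNz -mulNrz; apply: logderX; apply: logderV al.
exact: fps_mulVr.
Qed.

Lemma logder_prod (I : Type) (r : seq I) (f l : I -> fps F) :
  (forall i, logder (f i) (l i)) -> logder (\prod_(i <- r) f i) (\sum_(i <- r) l i).
Proof.
move=> fl; elim/big_ind2: _ => [|a a' b b' la lb|i _]; [exact: logder1| |exact: fl].
exact: logderM.
Qed.

Lemma fps_scaleM c a b : fps_scale c (a * b) = fps_scale c a * fps_scale c b.
Proof.
apply: fpsP => n; rewrite /fps_scale !fpsME mulr_sumr; apply: eq_bigr => i _.
have -> : c ^+ n = c ^+ i * c ^+ (n - i) by rewrite -exprD subnKC // -ltnS.
ring.
Qed.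

Lemma fps_deriv_scale c a :
  fps_deriv (fps_scale c a) = fpsC c * fps_scale c (fps_deriv a).
Proof.
by apply: fpsP => n; rewrite fpsCM /fps_deriv /fps_scale exprS -mulrA -!mulrnAr.
Qed.

Lemma logder_scale c a l : logder a l -> logder (fps_scale c a) (fps_scale c l).
Proof.
rewrite /logder !fps_deriv_scale => ->; rewrite fps_scaleM; ring.
Qed.

Lemma logder_rec a l n : logder a l ->
  a n.+1 *+ n.+1 = \sum_(i < n.+1) a i * (l (n - i).+1 *+ (n - i).+1).
Proof. by move/(congr1 (fun b : fps F => b n)). Qed.

(** Made for the exponent [c_1], which is -1 when [be] has no part 1. *)
Lemma fps_expz_sub1 a k : a 0%N = 1 -> fps_expz a (k%:Z - 1) * a = a ^+ k.
Proof.
move=> a0; case: k => [|k].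
  by rewrite (_ : 0%:Z - 1 = Negz 0) // /fps_expz fps_expE expr1 mulrC fps_mulVr.
by rewrite (_ : k.+1%:Z - 1 = Posz k) ?exprSr -?fps_expE // -addn1 PoszD addrK.
Qed.

Definition fps_even a := forall n, odd n -> a n = 0.

Lemma fps_even1 : fps_even 1.
Proof. by case. Qed.

Lemma fps_evenM a b : fps_even a -> fps_even b -> fps_even (a * b).
Proof.
move=> ea eb n n_odd; rewrite fpsME big1 // => i _.
have [/ea->|/negPf i_even] := boolP (odd i); first by rewrite mul0r.
by rewrite eb ?mulr0 // oddB ?n_odd ?i_even // -ltnS.
Qed.

Lemma fps_even_log a : fps_even a -> fps_even (fps_log a).
Proof.
move=> ea n n_odd; rewrite /fps_log /fps_comp big1 // => k _.
rewrite fps_expE.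
have eu : fps_even (a - 1) by move=> i i_odd; rewrite fpsBE ea // fps_even1 // subrr.
suff eX : fps_even ((a - 1) ^+ k) by rewrite [X in _ * X]eX // mulr0.
by elim: (nat_of_ord k) => [|j IHj]; [exact: fps_even1|rewrite exprS; exact: fps_evenM].
Qed.

End LogDerivative.

(** * Exponential series and products of sinh series *)

Definition fps_expc (c : algC) : fps algC := fun n => c ^+ n / n`!%:R.
(** The series of sinh(bz/2)/(bz/2), while [fps_expc c] is that of exp(cz). *)
Definition sinhcs (b : nat) : fps algC := fps_scale (b%:R / 2%:R) (fps_sinhc algC).

Lemma algC_nat_neq0 n : n.+1%:R != 0 :> algC.
Proof. by rewrite pnatr_eq0. Qed.

Lemma algC_fact_neq0 n : n`!%:R != 0 :> algC.
Proof. by rewrite pnatr_eq0 -lt0n fact_gt0. Qed.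

Lemma fps_expcD c e : fps_expc (c + e) = fps_expc c * fps_expc e.
Proof.
apply: fpsP => n; rewrite fpsME /fps_expc addrC exprDn mulr_suml.
apply: eq_bigr => i _; have le_in : (i <= n)%N by rewrite -ltnS.
rewrite -mulr_natr -(bin_fact le_in) !natrM.
field; rewrite !algC_fact_neq0 /=.
by rewrite pnatr_eq0 -lt0n bin_gt0.
Qed.

Lemma fps_expc0 : fps_expc 0 = 1.
Proof. by apply: fpsP => -[|n]; rewrite /fps_expc ?expr0 ?divr1 // expr0n mul0r. Qed.

Lemma fps_expcX c k : fps_expc c ^+ k = fps_expc (c *+ k).
Proof.
by elim: k => [|k IHk]; rewrite ?expr0 ?mulr0n ?fps_expc0 // exprS IHk -fps_expcD -mulrS.
Qed.

Lemma sinhcs0 b : sinhcs b 0%N = 1.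
Proof. by rewrite /sinhcs /fps_scale /fps_sinhc /fps_divX /fps_sinh /= expr0 mul1r invr1. Qed.

(** Both sides are 2 sinh(bz/2). *)
Lemma fps_expc_sub b : fps_expc (b%:R / 2%:R) - fps_expc (- (b%:R / 2%:R))
  = fpsC b%:R * (fpsX algC * sinhcs b).
Proof.
apply: fpsP => -[|n]; rewrite fpsCM fpsBE ?fpsXM0 /fps_expc ?expr0 ?subrr ?mulr0 //.
rewrite fpsXM /sinhcs /fps_scale /fps_sinhc /fps_divX /fps_sinh -mulrBl exprNn -signr_odd.
set x := b%:R / 2%:R; case: ifP => _; last by rewrite expr0 mul1r subrr mul0r !mulr0.
rewrite expr1 mulN1r opprK exprS (_ : b%:R = x + x); first by ring.
by rewrite /x; field.
Qed.

Lemma prod_count (R : comPzRingType) (f : nat -> R) d (s : seq nat) :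
  all (fun i => 0 < i <= d)%N s ->
  \prod_(b <- s) f b = \prod_(1 <= i < d.+1) f i ^+ count_mem i s.
Proof.
elim: s => [|b s IHs] /=; first by rewrite big_nil big1 // => i _; rewrite expr0.
case/andP=> b_in /IHs; rewrite big_cons => ->.
under [RHS]eq_bigr do rewrite exprD.
rewrite big_split /=; congr (_ * _).
rewrite (bigD1_seq b) ?iota_uniq ?mem_index_iota ?eqxx //=.
by rewrite expr1 big1 ?mulr1 // => i /negbTE; rewrite eq_sym => ->; rewrite expr0.
Qed.

Section SinhProduct.

Variables (d : nat) (be : seq nat).
Hypotheses (d_gt0 : (0 < d)%N) (be_bd : all (fun i => 0 < i <= d)%N be).

Lemma sinh_productE : sinh_product d be =
  \prod_(1 <= i < d.+1) fps_expz (sinhcs i) (c_mult be i).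
Proof. by []. Qed.

(** The factor [sinhcs 1] compensates the -1 in [c_1], turning all exponents into multiplicities. *)
Lemma sinh_product_mul : sinh_product d be * sinhcs 1 = \prod_(b <- be) sinhcs b.
Proof.
have lt1 : (1 < d.+1)%N by rewrite ltnS.
rewrite sinh_productE (prod_count _ be_bd) !(big_ltn lt1).
rewrite mulrAC /c_mult eqxx fps_expz_sub1 ?sinhcs0 //; congr (_ * _).
rewrite big_nat_cond [RHS]big_nat_cond; apply: eq_bigr => i /andP[/andP[i_gt1 _] _].
by rewrite (gtn_eqF i_gt1) subr0 /= fps_expE.
Qed.

Lemma sum_hook_exponentials (chi : nat -> algC) n : sumn be = d -> size be = n.+1 ->
  (1 - 'X) * (\sum_(k < d) chi k *: (- 'X) ^+ k) = \prod_(b <- be) (1 - 'X^b) :> {poly algC} ->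
  \sum_(k < d) fpsC ((-1) ^+ k * chi k) * fps_expc (d.-1%:R / 2%:R - k%:R)
    = fpsX algC ^+ n * (fpsC (\prod_(b <- be) b)%N%:R * sinh_product d be).
Proof.
move=> be_d be_n chiE; set T := \sum_(k < d) _.
(* The polynomial identity is evaluated at exp(-z). *)
pose y := fps_expc (-1).
have /(congr1 (fun p => (map_poly (@fpsC algC) p).[y])) := chiE.
rewrite rmorphM rmorph_prod rmorphB /= rmorph1 map_polyX hornerM !hornerE rmorph_sum horner_sum.
rewrite horner_prod => E.
have yX k : y ^+ k = fps_expc (- k%:R) by rewrite fps_expcX mulNrn.
have {E} E : (1 - y) * (\sum_(k < d) fpsC ((-1) ^+ k * chi k) * fps_expc (- k%:R))
           = \prod_(b <- be) (1 - fps_expc (- b%:R)).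
  rewrite (eq_bigr (fun b => 1 - fps_expc (- b%:R))) in E; last first.
    by move=> b _; rewrite rmorphB /= rmorph1 rmorphXn /= map_polyX !hornerE yX.
  rewrite -E; congr (_ * _); apply: eq_bigr => k _ /=.
  rewrite map_polyZ rmorphXn rmorphN /= map_polyX hornerZ horner_exp hornerN hornerX.
  by rewrite [(- y) ^+ k]exprNn yX rmorphM rmorph_sign; ring.
have TE : T = fps_expc (d.-1%:R / 2%:R) * \sum_(k < d) fpsC ((-1) ^+ k * chi k) * fps_expc (- k%:R).
  by rewrite mulr_sumr; apply: eq_bigr => k _; rewrite fps_expcD; ring.
(* The factors exp(z/2) and exp((d-1)z/2) combine to exp(dz/2), which splits over the parts and
   symmetrises each [1 - exp(-bz)]. *)
have E1 : (fps_expc (1%:R / 2%:R) * (1 - y)) * T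
        = \prod_(b <- be) (fps_expc (b%:R / 2%:R) - fps_expc (- (b%:R / 2%:R))).
  rewrite TE mulrACA E -fps_expcD -mulrDl -natrD add1n prednK // -be_d.
  rewrite (_ : fps_expc _ = \prod_(b <- be) fps_expc (b%:R / 2%:R)); last first.
    elim: (be) => [|b s IHs]; first by rewrite big_nil mul0r fps_expc0.
    by rewrite big_cons -IHs -fps_expcD -mulrDl -natrD.
  rewrite -big_split; apply: eq_bigr => b _ /=; rewrite mulrBr mulr1 -fps_expcD.
  by congr (_ - fps_expc _); field.
move: E1; rewrite mulrBr mulr1 -fps_expcD (_ : 1%:R / 2%:R + -1 = - (1%:R / 2%:R)); last by field.
rewrite fps_expc_sub rmorph1 mul1r.
under eq_bigr do rewrite fps_expc_sub.
rewrite !big_split /= -sinh_product_mul big_const_seq count_predT be_n.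
rewrite -/(iterop _ _ _ _) -Monoid.iteropE -/(fpsX algC ^+ n.+1) -rmorph_prod -natr_prod.
rewrite exprS => E1.
have {}E1 : fpsX algC * (T * sinhcs 1) = fpsX algC *
    (fpsX algC ^+ n * (fpsC (\prod_(b <- be) b)%N%:R * sinh_product d be) * sinhcs 1).
  by transitivity (fpsX algC * sinhcs 1 * T); [ring|rewrite E1; ring].
move/fpsX_inj/(congr1 (fun a => a * fps_inv (sinhcs 1))): E1.
by rewrite -!mulrA fps_mulVr ?sinhcs0 // !mulr1.
Qed.

End SinhProduct.

(** * Sums over partitions *)

Lemma sum_count (V : nmodType) (f : nat -> V) d (s : seq nat) :
  all (fun i => 0 < i <= d)%N s ->
  \sum_(b <- s) f b = \sum_(1 <= i < d.+1) f i *+ count_mem i s.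
Proof.
elim: s => [|b s IHs] /=; first by rewrite big_nil big1 // => i _; rewrite mulr0n.
case/andP=> b_in /IHs; rewrite big_cons => ->.
under [RHS]eq_bigr do rewrite mulrnDr.
rewrite big_split /=; congr (_ + _).
rewrite (bigD1_seq b) ?iota_uniq ?mem_index_iota ?eqxx //=.
by rewrite mulr1n big1 ?addr0 // => i /negbTE; rewrite eq_sym => ->; rewrite mulr0n.
Qed.

Lemma partition_bounded d la : is_partition d la -> all (fun i => 0 < i <= d)%N la.
Proof.
move=> la_part; apply/allP => i la_i; rewrite (mem_partition_gt0 la_part la_i) /=.
rewrite -(partition_sumn la_part) sumnE (big_rem i) //=; exact: leq_addr.
Qed.

Section PartitionSums.

Variable y : nat -> algC.

Definition part_weight (la : seq nat) : algC := (\prod_(i <- la) y i) / (aut_order la)%:R.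
(** The coefficient of [t^m] in the exponential of the sum of [y j t^j] over [j >= 1]. *)
Definition part_sum m : algC := \sum_(la <- partitions m) part_weight la.

Lemma aut_order_gt0 la : (0 < aut_order la)%N.
Proof. by apply: prodn_gt0 => i; apply: fact_gt0. Qed.

Lemma aut_order_perm la mu : perm_eq la mu -> aut_order la = aut_order mu.
Proof.
move=> e; rewrite /aut_order (perm_big _ (perm_undup (perm_mem e))).
by apply: eq_bigr => i _; rewrite (seq.permP e).
Qed.

Lemma aut_order_cons j mu : aut_order (j :: mu) = ((count_mem j mu).+1 * aut_order mu)%N.
Proof.
rewrite /aut_order /=; case: ifP => [mu_j|/negbT mu_j].
  rewrite !(bigD1_seq j) ?undup_uniq ?mem_undup //= eqxx add1n factS -!mulnA.
  congr (_ * (_ * _))%N; apply: eq_bigr => i ij; rewrite eq_sym (negbTE ij) //.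
rewrite big_cons eqxx (count_memPn mu_j) addn0 factS fact0 !mul1n.
rewrite [LHS]big_seq [RHS]big_seq; apply: eq_bigr => i; rewrite mem_undup => mu_i.
by case: eqP mu_i mu_j => // <- ->.
Qed.

Lemma part_weight_perm la mu : perm_eq la mu -> part_weight la = part_weight mu.
Proof. by move=> e; rewrite /part_weight (perm_big _ e) (aut_order_perm e). Qed.

Lemma part_weight_cons j mu :
  part_weight (j :: mu) * (count_mem j (j :: mu))%:R = y j * part_weight mu.
Proof.
rewrite /part_weight aut_order_cons big_cons /= eqxx add1n natrM.
by field; rewrite nat1r !pnatr_eq0 -lt0n aut_order_gt0.
Qed.

Lemma partitions_with_part m j : (0 < j <= m)%N ->
  perm_eq [seq la <- partitions m | j \in la]
          [seq sort geq (j :: mu) | mu <- partitions (m - j)].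
Proof.
case/andP=> j_gt0 le_jm; apply: uniq_perm.
- exact/filter_uniq/partitions_uniq.
- rewrite map_inj_in_uniq ?partitions_uniq // => mu nu; rewrite !mem_partitions => mu_p nu_p e.
  have : perm_eq (j :: mu) (j :: nu).
    by rewrite -(perm_sort geq) e perm_sort.
  rewrite perm_cons; apply: (sorted_eq geq_trans geq_anti).
    exact: partition_sorted mu_p.
  exact: partition_sorted nu_p.
move=> la; rewrite mem_filter mem_partitions; apply/andP/mapP => [[la_j la_p]|[mu]].
  exists (rem j la).
    rewrite mem_partitions; apply/and3P; split.
    - apply: (subseq_sorted geq_trans (rem_subseq j la)); exact: partition_sorted la_p.
    - by apply/negP => /mem_rem; apply/negP; case/and3P: la_p.
    - have := perm_sumn (perm_to_rem la_j); rewrite (partition_sumn la_p) /= => ->.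
      by rewrite addKn.
  apply: (sorted_eq geq_trans geq_anti (partition_sorted la_p) (sort_sorted geq_total _)).
  by rewrite perm_sym perm_sort perm_sym perm_to_rem.
rewrite mem_partitions => mu_p ->; rewrite mem_sort mem_head; split=> //.
apply/and3P; split; first exact: sort_sorted geq_total _.
  by rewrite mem_sort inE negb_or eq_sym -lt0n j_gt0; case/and3P: mu_p.
have -> : sumn (sort geq (j :: mu)) = sumn (j :: mu) by apply: perm_sumn; rewrite perm_sort.
by rewrite /= (partition_sumn mu_p) subnKC.
Qed.

Lemma part_sum0 : part_sum 0 = 1.
Proof.
rewrite /part_sum (_ : partitions 0 = [:: [::]]); last first.
  apply: perm_small_eq => //; apply: uniq_perm => // [|la]; first exact: partitions_uniq.
  rewrite mem_partitions inE; apply/idP/eqP => [la_p|-> //].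
  case: la la_p => // i la la_p; have := partition_sumn la_p.
  by have := mem_partition_gt0 la_p (mem_head i la); rewrite /=; lia.
by rewrite big_seq1 /part_weight big_nil /aut_order big_nil divr1.
Qed.

(** Write [m] as the sum of [j] times the multiplicity of [j] in each partition, then remove one
    part [j]; the multiplicity cancels against the automorphism count. *)
Lemma part_sum_rec m :
  m%:R * part_sum m = \sum_(1 <= j < m.+1) j%:R * y j * part_sum (m - j).
Proof.
rewrite /part_sum mulr_sumr.
transitivity (\sum_(la <- partitions m) \sum_(1 <= j < m.+1) j%:R * (part_weight la * (count_mem j la)%:R)).
  rewrite big_seq [RHS]big_seq; apply: eq_bigr => la; rewrite mem_partitions => la_p.
  rewrite -{1}(partition_sumn la_p) sumnE natr_sum (sum_count _ (partition_bounded la_p)).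
  by rewrite mulr_suml; apply: eq_bigr => j _; rewrite -mulr_natr; ring.
rewrite exchange_big /= [LHS]big_nat [RHS]big_nat; apply: eq_bigr => j j_in.
rewrite -mulr_sumr -mulrA; congr (_ * _).
rewrite (bigID (fun la => j \in la)) /= [X in _ + X]big1 ?addr0 => [|la /count_memPn->]; last first.
  by rewrite mulr0.
rewrite -big_filter (perm_big _ (partitions_with_part _)) ?big_map; last by lia.
rewrite mulr_sumr; apply: eq_bigr => mu _.
have e : perm_eq (sort geq (j :: mu)) (j :: mu) by rewrite perm_sort.
by rewrite (part_weight_perm e) (seq.permP e) part_weight_cons.
Qed.

Lemma part_sum_unique (q : nat -> algC) : q 0%N = 1 ->
  (forall m, m%:R * q m = \sum_(1 <= j < m.+1) j%:R * y j * q (m - j)%N) ->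
  forall m, q m = part_sum m.
Proof.
move=> q0 q_rec; elim/ltn_ind => -[|m] IHm; first by rewrite q0 part_sum0.
apply: (mulfI (algC_nat_neq0 m)); rewrite q_rec part_sum_rec.
rewrite !big_nat; apply: eq_bigr => j j_in; rewrite IHm //; lia.
Qed.

End PartitionSums.

Lemma sum_odd_vanish (f : nat -> algC) m : (forall i, (i < 2 * m)%N -> odd i -> f i = 0) ->
  \sum_(i < 2 * m) f i = \sum_(j < m) f (2 * j)%N.
Proof.
elim: m => [|m IHm] f0; first by rewrite !big_ord0.
rewrite mulnS add2n !big_ord_recr /= IHm => [|i lt_i]; last by apply: f0; lia.
by rewrite [f (2 * m).+1]f0 ?addr0 //; lia.
Qed.

(** * Coefficients of the sinh product as partition sums *)

Section SinhProductCoef.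

Variables (d : nat) (be : seq nat).
Hypotheses (d_gt0 : (0 < d)%N) (be_bd : all (fun i => 0 < i <= d)%N be).

(** The logarithm of the sinh product: [Spow be n] is the sum of [c_i i^n], and the scaling by [i/2]
    gives the power of 2. *)
Definition sinh_log : fps algC := fun n => (2%:R ^+ n)^-1 * xi n * Spow be n.

Lemma sinhc_logder : logder (fps_sinhc algC) (fps_log (fps_sinhc algC)).
Proof. by apply: (fps_log_deriv algC_nat_neq0); have := sinhcs0 0; rewrite /sinhcs /fps_scale expr0 mul1r. Qed.

Lemma sinh_product_logder : logder (sinh_product d be) sinh_log.
Proof.
rewrite sinh_productE.
have -> : sinh_log = \sum_(1 <= i < d.+1)
    fps_scale (i%:R / 2%:R) (fps_log (fps_sinhc algC)) *~ c_mult be i.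
  apply: fpsP => n; rewrite fps_sumE /sinh_log /Spow (sum_count _ be_bd).
  have zE (a : fps algC) (c : int) : (a *~ c) n = a n *~ c.
    have nE k : (a *+ k) n = a n *+ k by elim: k => // k IHk; rewrite !mulrS fpsDE IHk.
    by case: c => k; rewrite ?NegzE ?mulrNz ?fpsNE -!pmulrn nE.
  under [RHS]eq_bigr do rewrite zE /c_mult mulrzBr /fps_scale.
  rewrite sumrB [X in _ - X](_ : _ = (2%:R ^+ n)^-1 * xi n); last first.
    rewrite big_ltn // big_nat big1 ?addr0 => [|i /andP[i_gt1 _]].
      by rewrite eqxx mulr1z expr_div_n expr1n mul1r.
    by rewrite (gtn_eqF i_gt1) mulr0z.
  rewrite mulrDr mulrN1 addrC; congr (_ - _); rewrite mulr_sumr.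
  by apply: eq_bigr => i _; rewrite -pmulrn mulrnAr expr_div_n /xi; congr (_ *+ _); ring.
by apply: logder_prod => i; apply: logder_expz; [exact: sinhcs0|exact/logder_scale/sinhc_logder].
Qed.

Lemma xi_odd n : odd n -> xi n = 0.
Proof.
apply: fps_even_log => i i_odd.
by rewrite /fps_sinhc /fps_divX /fps_sinh /= i_odd.
Qed.

Lemma sinh_product0 : sinh_product d be 0%N = 1.
Proof.
have := congr1 (fun a : fps algC => a 0%N) (sinh_product_mul d_gt0 be_bd).
rewrite /= fpsME0 sinhcs0 mulr1 => ->; elim: (be) => [|b s IHs]; first by rewrite big_nil.
by rewrite big_cons fpsME0 sinhcs0 IHs mulr1.
Qed.

Lemma sinh_product_even_coef m : sinh_product d be (2 * m)%N
  = (4%:R ^+ m)^-1 * \sum_(la <- partitions m) xi_part la * Spow_part be la / (aut_order la)%:R.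
Proof.
set A := sinh_product d be.
have -> : A (2 * m)%N = part_sum (fun j => sinh_log (2 * j)) m.
  apply: (@part_sum_unique _ (fun m => A (2 * m)%N)); first exact: sinh_product0.
  case=> [|k]; first by rewrite mul0r big_geq.
  (* Odd coefficients of the logarithm vanish, so only even indices survive; halving gives the
     recursion that characterises [part_sum]. *)
  have := logder_rec (2 * k).+1 sinh_product_logder; rewrite -/A.
  have -> : (2 * k).+2 = (2 * k.+1)%N by lia.
  rewrite (sum_odd_vanish (f := fun i => A i * (sinh_log ((2 * k).+1 - i).+1 *+ ((2 * k).+1 - i).+1))).
    move=> E; apply: (mulfI (algC_nat_neq0 1)); rewrite mulrA -natrM mulr_natl E.
    rewrite mulr_sumr big_add1 /= big_mkord (reindex_inj rev_ord_inj) /=.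
    apply: eq_bigr => j _; have lt_j := ltn_ord j.
    have -> : ((2 * k).+1 - 2 * (k.+1 - j.+1))%N.+1 = (2 * j.+1)%N by lia.
    have -> : (k.+1 - j.+1 = k - j)%N by lia.
    by rewrite -[_ *+ (2 * j.+1)]mulr_natr natrM; ring.
  move=> i lt_i i_odd.
  rewrite /sinh_log xi_odd ?mulr0 ?mul0r ?mul0rn ?mulr0 //; lia.
rewrite /part_sum mulr_sumr big_seq [RHS]big_seq; apply: eq_bigr => la.
rewrite mem_partitions => la_p; rewrite /part_weight mulrA; congr (_ / _).
rewrite /xi_part /Spow_part /sinh_log !big_split /= mulrA; congr (_ * _ * _).
rewrite -(partition_sumn la_p); elim: (la) => [|i s IHs]; first by rewrite big_nil expr0 invr1.
by rewrite big_cons IHs /= exprD invfM; congr (_ * _); rewrite exprM -natrX.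
Qed.

End SinhProductCoef.

(** * Hurwitz numbers *)

Lemma shifted_psum_hook d k : (k < d)%N ->
  shifted_psum algC 3 (hook d k) / 3`!%:R
    = d%:R / 2%:R * ((d.-1%:R / 2%:R - k%:R) ^+ 2 + d%:R ^+ 2 / 12%:R).
Proof.
move=> lt_kd; rewrite /shifted_psum /= size_nseq big_ord_recl /=.
(* The rows of length 1 shift the base point by one, so their contributions telescope. *)
have -> : \sum_(i < k) (((nth 0 (nseq k 1) i)%:R - (lift ord0 i).+1%:R + 2%:R^-1) ^+ 3
    - (- (lift ord0 i).+1%:R + 2%:R^-1) ^+ 3) = (- 1%:R + 2%:R^-1) ^+ 3 - (- k.+1%:R + 2%:R^-1) ^+ 3 :> algC.
  transitivity (\sum_(i < k) ((- i.+1%:R + 2%:R^-1) ^+ 3 - (- i.+2%:R + 2%:R^-1) ^+ 3 : algC)).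
    apply: eq_bigr => i _; rewrite nth_nseq ltn_ord /=; congr (_ ^+ 3 - _).
    by rewrite /bump /= add1n -[i.+2%:R]natr1; ring.
  elim: k {lt_kd} => [|k IHk]; first by rewrite big_ord0 subrr.
  by rewrite big_ord_recr /= IHk; ring.
rewrite natrB ?(ltnW lt_kd) // -[k.+1%:R]natr1.
have -> : d.-1%:R = d%:R - 1 :> algC by rewrite -subn1 natrB //; lia.
rewrite (_ : 3`! = 6) //.
by field.
Qed.

Lemma is_hookP d la : (0 < d)%N -> is_partition d la -> (nth 0 la 1 <= 1)%N ->
  exists2 k, (k < d)%N & la = hook d k.
Proof.
move=> d_gt0 la_p la1; have sum_la := partition_sumn la_p.
case: la la_p la1 sum_la => [|a r] la_p la1 sum_la; first by rewrite -sum_la in d_gt0.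
have rE : r = nseq (size r) 1%N.
  apply/all_pred1P/allP => i ri; have i_gt0 := mem_partition_gt0 la_p (mem_behead (s := a :: r) ri).
  have : (i <= nth 0 r 0)%N.
    have := partition_sorted la_p; rewrite /= path_sortedE; last exact: geq_trans.
    case/andP=> _; case: (r) ri => // b t; rewrite /= path_sortedE; last exact: geq_trans.
    by rewrite inE => /predU1P[-> //|it] /andP[/allP/(_ _ it)].
  by move: la1 => /= *; apply/eqP; lia.
have a_gt0 := mem_partition_gt0 la_p (mem_head a r).
move: sum_la => /=; rewrite rE sumn_nseq mul1n => sum_la.
by exists (size r); [lia|rewrite /hook -rE; congr (_ :: _); lia].
Qed.

Lemma sum_over_hooks d (f : seq nat -> algC) : (0 < d)%N ->
  (forall la, is_partition d la -> (1 < nth 0 la 1)%N -> f la = 0) ->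
  \sum_(la <- partitions d) f la = \sum_(k < d) f (hook d k).
Proof.
move=> d_gt0 f0; rewrite (bigID (fun la => nth 0 la 1 <= 1)%N) /= [X in _ + X]big1_seq ?addr0; last first.
  by move=> la /andP[]; rewrite -ltnNge mem_partitions => la1 la_p; apply: f0.
rewrite -big_filter -(big_mkord xpredT (fun k => f (hook d k))) -(big_map (hook d) xpredT f).
apply: perm_big; apply: uniq_perm.
- exact/filter_uniq/partitions_uniq.
- rewrite map_inj_uniq ?iota_uniq // => j k [_] /(congr1 size).
  by rewrite !size_nseq.
move=> la; rewrite mem_filter mem_partitions; apply/andP/mapP => [[la1 la_p]|[k]].
  have [k lt_k ->] := is_hookP d_gt0 la_p la1.
  by exists k; rewrite // mem_index_iota.
rewrite mem_index_iota => lt_k ->; split; last exact: hook_is_partition.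
by rewrite /= nth_nseq; case: ifP.
Qed.

Lemma hurwitz_hooks s d be : (0 < d)%N ->
  hurwitz 2 s d [:: d] be
    = (d%:R * (\prod_(b <- be) b)%N%:R)^-1 *
      \sum_(k < d) (-1) ^+ k
        * (d%:R / 2%:R * ((d.-1%:R / 2%:R - k%:R) ^+ 2 + d%:R ^+ 2 / 12%:R)) ^+ s
        * specht_char d (hook d k) (perm_of_type d be).
Proof.
move=> d_gt0; rewrite /hurwitz big_seq1; congr (_ * _).
have cycle : cycle_type (perm_of_type d [:: d]) = [:: d].
  apply: perm_of_typeP => //; apply/and3P; split=> //=; last by rewrite addn0.
  by rewrite inE eq_sym -lt0n.
rewrite sum_over_hooks // => [|la la_p la1]; last first.
  by rewrite /sym_char (specht_nonhook_cycle d_gt0 cycle) // !mul0r.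
apply: eq_bigr => k _; rewrite /sym_char (hook_char_cycle d_gt0 cycle) //.
by rewrite shifted_psum_hook.
Qed.

Lemma hook_moments d be n m : (0 < d)%N -> is_partition d be -> size be = n.+1 ->
  \sum_(k < d) (-1) ^+ k * specht_char d (hook d k) (perm_of_type d be)
       * (d.-1%:R / 2%:R - k%:R) ^+ m
    = m`!%:R * (\prod_(b <- be) b)%N%:R * (fpsX algC ^+ n * sinh_product d be) m.
Proof.
move=> d_gt0 be_p be_n; have := hook_char_poly d_gt0 (perm_of_type d be).
rewrite (prod_cycle_type _ (fun b => 1 - 'X^b)) perm_of_typeP //.
move/(@sum_hook_exponentials d be d_gt0 (partition_bounded be_p) (fun k => specht_char d (hook d k) (perm_of_type d be)) n (partition_sumn be_p) be_n).
move/(congr1 (fun a : fps algC => a m)); rewrite fps_sumE mulrCA fpsCM.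
rewrite -mulrA => <-; rewrite mulr_sumr; apply: eq_bigr => k _.
by rewrite fpsCM /fps_expc; field; exact: algC_fact_neq0.
Qed.

Lemma hurwitz_sinh (g d s : nat) (be : seq nat) (hd : (0 < d)%N)
    (hbe : is_partition d be) n : size be = n.+1 -> (2 * s = 2 * g + n)%N ->
  hurwitz 2 s d [:: d] be
    = s`!%:R * (d%:R : algC) ^ (s%:Z - 1) / 2%:R ^+ s
      * \sum_(0 <= h < g.+1)
          (2 * s - 2 * h)`!%:R / (h`!%:R * (s - h)`!%:R * 12%:R ^+ h)
          * d%:R ^+ (2 * h) * sinh_product d be (2 * (g - h))%N.
Proof.
move=> be_n hs; have d0 : d%:R != 0 :> algC by rewrite pnatr_eq0 -lt0n.
have B0 : (\prod_(b <- be) b)%N%:R != 0 :> algC.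
  rewrite natr_prod prodf_seq_neq0; apply/allP => b be_b.
  by rewrite implyTb pnatr_eq0 -lt0n (mem_partition_gt0 hbe).
rewrite hurwitz_hooks //; set B := (\prod_(b <- be) b)%N%:R in B0 *.
set SP := sinh_product d be; set chi := fun k => specht_char d (hook d k) (perm_of_type d be).
pose w (k : nat) : algC := d.-1%:R / 2%:R - k%:R.
pose c (h : nat) : algC := (d%:R ^+ 2 / 12%:R) ^+ h * 'C(s, h)%:R.
(* Binomial expansion of the [s]-th power reduces the sum over hooks to moments of [w]. *)
transitivity ((d%:R * B)^-1 * \sum_(h < s.+1) (d%:R / 2%:R) ^+ s * c h
    * \sum_(k < d) (-1) ^+ k * chi k * w k ^+ (2 * (s - h))).
  congr (_ * _); under [RHS]eq_bigr do rewrite mulr_sumr.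
  rewrite exchange_big; apply: eq_bigr => k _ /=.
  rewrite exprMn exprDn mulr_sumr mulr_sumr mulr_suml; apply: eq_bigr => h _.
  by rewrite -exprM -/(w k) -[_ *+ 'C(s, h)]mulr_natr /c /chi; ring.
have inner h : \sum_(k < d) (-1) ^+ k * chi k * w k ^+ (2 * (s - h))
    = (2 * (s - h))`!%:R * B * (fpsX algC ^+ n * SP) (2 * (s - h))%N.
  exact: hook_moments.
have le_gs : (g <= s)%N by lia.
rewrite -(big_mkord xpredT (fun h => (d%:R / 2%:R) ^+ s * c h * \sum_(k < d) (-1) ^+ k * chi k * w k ^+ (2 * (s - h)))).
(* For [h > g] the degree [2 * (s - h)] is below [n], so the factor [fpsX ^+ n] kills the
   coefficient. *)
rewrite (big_cat_nat (n := g.+1)) //= [X in _ + X]big_nat [X in _ + X]big1 ?addr0; last first.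
  by move=> h h_in; rewrite inner fpsXnM_lt ?mulr0 //; lia.
rewrite mulr_sumr mulr_sumr [LHS]big_nat [RHS]big_nat; apply: eq_bigr => h h_in.
rewrite inner; have -> : (2 * (s - h) = 2 * (g - h) + n)%N by lia.
rewrite fpsXnM -/SP; have -> : (2 * (g - h) + n = 2 * s - 2 * h)%N by lia.
have le_hs : (h <= s)%N by lia.
(* The exponent is an integer power, equal to -1 when [s = 0]. *)
have -> : d%:R ^ (s%:Z - 1) = d%:R ^+ s / d%:R :> algC.
  by rewrite expfzDr // exprN1.
rewrite /c -(bin_fact le_hs) !natrM !expr_div_n exprM; field.
by rewrite !expf_neq0 ?algC_fact_neq0 ?d0 ?B0 // pnatr_eq0.
Qed.

Theorem theorem1p2 (g d s : nat) (be : seq nat) (hd : (0 < d)%N)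
    (hbe : is_partition d be) (hodd : odd (size be))
    (hs : (2 * s)%:Z = (2 * g)%:Z - 1 + (size be)%:Z) :
  hurwitz 2 s d [:: d] be
    = s`!%:R * (d%:R : algC) ^ (s%:Z - 1) / 2%:R ^+ s
      * \sum_(0 <= h < g.+1)
          (2 * s - 2 * h)`!%:R / (h`!%:R * (s - h)`!%:R * 12%:R ^+ h)
          * d%:R ^+ (2 * h) * sinh_product d be (2 * (g - h))%N
  /\
  s`!%:R * (d%:R : algC) ^ (s%:Z - 1) / 2%:R ^+ s
      * \sum_(0 <= h < g.+1)
          (2 * s - 2 * h)`!%:R / (h`!%:R * (s - h)`!%:R * 12%:R ^+ h)
          * d%:R ^+ (2 * h) * sinh_product d be (2 * (g - h))%N
    = s`!%:R * (d%:R : algC) ^ (s%:Z - 1) / 2%:R ^+ (s + 2 * g)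
      * \sum_(0 <= h < g.+1)
          (2 * s - 2 * h)`!%:R / (h`!%:R * (s - h)`!%:R * 3%:R ^+ h)
          * d%:R ^+ (2 * h)
          * \sum_(la <- partitions (g - h))
               xi_part la * Spow_part be la / (aut_order la)%:R.
Proof.
case be_n : (size be) hodd hs => [//|n] _ hs'.
have {}hs' : (2 * s = 2 * g + n)%N by lia.
split; first exact: hurwitz_sinh be_n hs'.
rewrite !mulr_sumr; apply: eq_big_nat => h /andP[_ le_hg].
rewrite (sinh_product_even_coef hd (partition_bounded hbe)).
set S := \sum_(la <- _) _; set D := _ ^ _.
(* Of the factor [2^(2g) = 4^g], the part [4^(g - h)] comes from the coefficient of the sinh product
   and [4^h] turns [12^h] into [3^h]. *)
have -> : 2%:R ^+ (s + 2 * g) = 2%:R ^+ s * (4%:R ^+ h * 4%:R ^+ (g - h)) :> algC.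
  by rewrite -exprD subnKC // exprD exprM -(natrX _ 2 2).
have -> : 12%:R ^+ h = 4%:R ^+ h * 3%:R ^+ h :> algC by rewrite -exprMn -natrM.
by field; rewrite !expf_neq0 ?algC_fact_neq0 // pnatr_eq0.
Qed.
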